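(* Let $\mathcal{D}=(G,\chi,z,\lambda,q)$, $n$, $p=\chi(z)$ and $H_{\mathcal{D}}$ be as in the context, with $(p,q)\neq(1,-1)$, and let $B$ be a $k$-algebra. Each data consisting of - a $G(\chi,z)^{\mathrm{op}}$-gradation $B=\bigoplus_{(g,\zeta)\in G(\chi,z)^{\mathrm{op}}}B_{g,\zeta}$ of $B$ as a vector space, - an algebra automorphism $\alpha\colon B\to B$ such that $\alpha^n=\mathrm{id}$ if $\lambda(z^n-1_G)\neq0$, and $\alpha(B_{g,\zeta})=B_{g,\zeta}$ for all $(g,\zeta)\in G(\chi,z)^{\mathrm{op}}$, - a map $U\colon B\to B$ such that: the decomposition $B=\bigoplus B_{g,\zeta}$ is compatible with $\mathcal{D}$; $U\circ\alpha=q\,\alpha\circ U$; $U^n=0$; $U(B_{g,\zeta})\subseteq B_{z^{-1}g,\zeta}$ for all $(g,\zeta)\in G(\chi,z)^{\mathrm{op}}$; and $$U(bc)=bU(c)+\chi(h)U(b)\alpha(c)\qquad\text{for all } b\in B,\ h\in G \text{ and } c\in B_h,$$ where $B_h:=\bigoplus_{\zeta\in\mathrm{Aut}_{\chi,z}(G)}B_{h,\zeta}$ for all $h\in G$, determines a right $H_{\mathcal{D}}$-comodule algebra $(B,s)$, in which $s\colon H_{\mathcal{D}}\otimes B\to B\otimes H_{\mathcal{D}}$ is the left transposition of $H_{\mathcal{D}}$ on $B$ given by $$s(gx^i\otimes b)=\alpha^i(b)\otimes\zeta(g)x^i\quad\text{for } b\in B_{\zeta}:=\bigoplus_{g\in G}B_{g,\zeta},\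 \zeta\in\mathrm{Aut}_{\chi,z}(G),$$ and the coaction $\nu\colon B\to B\otimes H_{\mathcal{D}}$ is given by $$\nu(b):=\sum_{i=0}^{n-1}\frac{1}{(i)!_{qp}}U^i(b)\otimes z^{-i}gx^i\qquad\text{for all } b\in B_g,\ g\in G.$$ Furthermore, all the right $H_{\mathcal{D}}$-comodule algebra structures with underlying algebra $B$ are obtained in this way.
   Context: $k$ is a field, all maps are $k$-linear, $\otimes=\otimes_k$, algebras are associative unital, and the name of a space also denotes its identity map. For $t\in k$, $(j)_t=\sum_{i=0}^{j-1}t^i$ and $(j)!_t=(1)_t(2)_t\cdots(j)_t$. Data: $G$ is a finite group, $\chi\colon G\to k^\times$ a character, $z\in G$ central, $q\in k^\times$, $\lambda\in k$, $p:=\chi(z)$; $qp$ is a root of $1$ of order $n>1$; and $\chi^n=1$ if $\lambda(z^n-1_G)\ne0$. $H_{\mathcal D}$ is the braided Hopf algebra generated as an algebra by the group $G$ and an element $x$ with relations $x^n=\lambda(z^n-1_G)$, $xg=\chi(g)gx$ ($g\in G$); it has basis $\{gx^i:g\in G,0\le i<n\}$, comultiplication and counit determined by $\Delta(g)=g\otimes g$, $\Delta(x)=1\otimes x+x\otimes z$, $\epsilon(g)=1$, $\epsilon(x)=0$, and braid $c=c_q$, $c_q(gx^i\otimes hx^j)=q^{ij}hx^j\otimes gx^i$. (As in any braided bialgebra, $\Delta\mu=(\mu\otimes\mu)(H\otimes c\otimes H)(\Delta\otimes\Delta)$.) $\mathrm{Aut}_{\chi,z}(G)$ is the group of automorphisms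 $\phi$ of $G$ with $\phi(z)=z$ and $\chi\circ\phi=\chi$. It acts on $G^{\mathrm{op}}$ by $\zeta\cdot g=\zeta(g)$, and $G(\chi,z):=G^{\mathrm{op}}\rtimes\mathrm{Aut}_{\chi,z}(G)$. Thus in $G(\chi,z)^{\mathrm{op}}$ (underlying set $G\times\mathrm{Aut}_{\chi,z}(G)$) the product is $(g,\zeta)(h,\phi)=(\phi(g)h,\phi\circ\zeta)$. Compatibility with $\mathcal D$: given an algebra $B$ with an algebra automorphism $\alpha$, a map $U\colon B\to B$ and a $G(\chi,z)^{\mathrm{op}}$-gradation $B=\bigoplus B_{g,\zeta}$ as a vector space, the decomposition is compatible with $\mathcal D$ if one of the following holds: (1) $\lambda(z^n-1_G)=0$ and the decomposition is a gradation of $B$ as an algebra; (2) $\lambda(z^n-1_G)\neq0$, $1_B\in B_{1_G,\mathrm{id}}$, $B_{g,\zeta}B_{h,\phi}\subseteq B_{\phi(g)h,\phi\circ\zeta}\oplus B_{z^{-n}\phi(g)h,\phi\circ\zeta}$ for all $(g,\zeta),(h,\phi)$, and for each $b\in B_{g,\zeta}$, $c\in B_{h,\phi}$ the homogeneous component of $bc$ of degree $(z^{-n}\phi(g)h,\phi\circ\zeta)$ is $$(bc)_{z^{-n}\phi(g)h,\phi\circ\zeta}=-\lambda\sum_{j=1}^{n-1}\frac{p^{j^2}\chi(h)^j}{(j)!_{qp}(n-j)!_{qp}}U^j(b)\,\alpha^j\bigl(U^{n-j}(c)\bigr).$$ For a braided bialgebra $H$ with braid $c$, a left $H$-space is a pair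 $(V,s)$ with $s\colon H\otimes V\to V\otimes H$ a bijective map such that: $s(1_H\otimes v)=v\otimes1_H$; $s\circ(\mu\otimes V)=(V\otimes\mu)\circ(s\otimes H)\circ(H\otimes s)$; $(V\otimes\epsilon)\circ s=\epsilon\otimes V$; $(V\otimes\Delta)\circ s=(s\otimes H)\circ(H\otimes s)\circ(\Delta\otimes V)$; and $(s\otimes H)\circ(H\otimes s)\circ(c\otimes V)=(V\otimes c)\circ(s\otimes H)\circ(H\otimes s)$. A left transposition of $H$ on an algebra $B$ is an $s$ such that $(B,s)$ is a left $H$-space, $s(h\otimes1_B)=1_B\otimes h$ and $s\circ(H\otimes\mu_B)=(\mu_B\otimes H)\circ(B\otimes s)\circ(s\otimes B)$. A right $H$-comodule algebra $(B,s)$ is an algebra $B$ with an ordinary right $H$-comodule structure $\nu\colon B\to B\otimes H$ and a left transposition $s$ of $H$ on the algebra $B$ such that $(\nu\otimes H)\circ s=(B\otimes c)\circ(s\otimes H)\circ(H\otimes\nu)$, $\nu\circ\mu_B=(\mu_B\otimes\mu_H)\circ(B\otimes s\otimes H)\circ(\nu\otimes\nu)$ and $\nu(1_B)=1_B\otimes1_H$. *)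

(* Defs.v *)
(* Mathematical Components, with mathcomp-classical for Prop-valued subsets and
   for deciding the relation that defines the tensor product. *)
From HB Require Import structures.
From mathcomp Require Import all_boot all_order all_algebra all_fingroup.
From mathcomp Require Import sesquilinear generic_quotient.
From mathcomp Require Import boolp classical_sets.

Set Implicit Arguments.
Unset Strict Implicit.
Unset Printing Implicit Defensive.

Import GRing.Theory.
Local Open Scope ring_scope.
Local Open Scope quotient_scope.

Reserved Notation "V \ox W" (at level 40, left associativity).
Reserved Notation "v \ot w" (at level 40, left associativity).
Reserved Notation "f \om g" (at level 40, left associativity).

(* Associative unital algebras. The library's [algType] requires 1 != 0; here the
   zero algebra is allowed. *)

Record pzAlgebra (k : fieldType) := PzAlgebra {
  pzalg_ring : pzRingType;
  pzalg_scale : k -> pzalg_ring -> pzalg_ring;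
  pzalg_scaleA : forall a b v,
    pzalg_scale a (pzalg_scale b v) = pzalg_scale (a * b) v;
  pzalg_scale1 : left_id 1 pzalg_scale;
  pzalg_scaleDr : right_distributive pzalg_scale +%R;
  pzalg_scaleDl : forall v, {morph pzalg_scale^~ v : a b / a + b};
  pzalg_scaleAl : forall a u v, pzalg_scale a (u * v) = pzalg_scale a u * v;
  pzalg_scaleAr : forall a u v, pzalg_scale a (u * v) = u * pzalg_scale a v
}.

Definition pzalg_sort (k : fieldType) (A : pzAlgebra k) : Type := pzalg_ring A.
Coercion pzalg_sort : pzAlgebra >-> Sortclass.

Section PzAlgebraTheory.
Variables (k : fieldType) (A : pzAlgebra k).

HB.instance Definition _ := GRing.PzRing.on (pzalg_sort A).
HB.instance Definition _ := GRing.Zmodule_isLmodule.Build k (pzalg_sort A)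
  (@pzalg_scaleA k A) (@pzalg_scale1 k A) (@pzalg_scaleDr k A)
  (@pzalg_scaleDl k A).

Lemma pzscalerAl (a : k) (u v : A) : a *: (u * v) = (a *: u) * v.
Proof. exact: pzalg_scaleAl. Qed.
Lemma pzscalerAr (a : k) (u v : A) : a *: (u * v) = u * (a *: v).
Proof. exact: pzalg_scaleAr. Qed.

End PzAlgebraTheory.

Local Notation bilin f := (bilinear_for
  (GRing.Scale.Law.clone _ _ *:%R _) (GRing.Scale.Law.clone _ _ *:%R _) f).

(* Formal sums of pairs, two of which are identified when every bilinear map
   takes the same value on them: the universal property is built in ([tlift]),
   and coincides with the quotient by the bilinearity relations. *)

Section Tensor.
Variables (k : fieldType) (V W : lmodType k).
Implicit Types (X : lmodType k) (s t : seq (V * W)).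

Definition bisum X (f : V -> W -> X) s : X := \sum_(p <- s) f p.1 p.2.

Definition tens_eq s t : bool :=
  `[< forall X (f : {bilinear V -> W -> X}), bisum f s = bisum f t >].

Lemma tens_eq_equiv : equiv_class_of tens_eq.
Proof.
split=> [s|s t|t s u].
- by apply/asboolP.
- by apply: asbool_equiv_eq; split=> h X f; rewrite h.
- move=> /asboolP st /asboolP tu; apply/asboolP=> X f.
  by rewrite st tu.
Qed.

Canonical tens_equiv := EquivRelPack tens_eq_equiv.

Definition tens := {eq_quot tens_eq}.
HB.instance Definition _ := Choice.on tens.
HB.instance Definition _ := EqQuotient.on tens.

Definition tens_of s : tens := \pi_tens s.

Lemma tens_ofP s t :
  (forall X (f : {bilinear V -> W -> X}), bisum f s = bisum f t) <->
  tens_of s = tens_of t.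
Proof.
split=> [h|/eqmodP /asboolP //].
by apply/eqmodP/asboolP.
Qed.

Lemma tens_of_repr (t : tens) : tens_of (repr t) = t.
Proof. exact: reprK. Qed.

Lemma bisum_repr X (f : {bilinear V -> W -> X}) s :
  bisum f (repr (tens_of s)) = bisum f s.
Proof. by move: X f; apply/tens_ofP; rewrite tens_of_repr. Qed.

Definition scale_pairs (a : k) s := [seq (a *: p.1, p.2) | p <- s].

Lemma bisum_cat X (f : V -> W -> X) s t :
  bisum f (s ++ t) = bisum f s + bisum f t.
Proof. exact: big_cat. Qed.

Lemma bisum_scale X (f : {bilinear V -> W -> X}) a s :
  bisum f (scale_pairs a s) = a *: bisum f s.
Proof.
rewrite /bisum big_map scaler_sumr; apply: eq_bigr => p _ /=.
by rewrite linearZl_LR.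
Qed.

Definition tens_add (x y : tens) : tens := tens_of (repr x ++ repr y).
Definition tens_scale (a : k) (x : tens) : tens :=
  tens_of (scale_pairs a (repr x)).
Definition tens_opp (x : tens) : tens := tens_scale (-1) x.
Definition tens_zero : tens := tens_of [::].

Lemma tens_eqP (x y : tens) :
  (forall X (f : {bilinear V -> W -> X}),
     bisum f (repr x) = bisum f (repr y)) -> x = y.
Proof. by move=> /tens_ofP; rewrite !tens_of_repr. Qed.

Lemma bisum_add X (f : {bilinear V -> W -> X}) (x y : tens) :
  bisum f (repr (tens_add x y)) = bisum f (repr x) + bisum f (repr y).
Proof. by rewrite bisum_repr bisum_cat. Qed.

Lemma bisum_scaler X (f : {bilinear V -> W -> X}) a (x : tens) :
  bisum f (repr (tens_scale a x)) = a *: bisum f (repr x).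
Proof. by rewrite bisum_repr bisum_scale. Qed.

Lemma bisum_zero X (f : {bilinear V -> W -> X}) :
  bisum f (repr tens_zero) = 0.
Proof. by rewrite bisum_repr /bisum big_nil. Qed.

Definition bisumE := (bisum_add, bisum_scaler, bisum_zero).

Lemma tens_addA : associative tens_add.
Proof. by move=> x y u; apply: tens_eqP => X f; rewrite !bisumE addrA. Qed.
Lemma tens_addC : commutative tens_add.
Proof. by move=> x y; apply: tens_eqP => X f; rewrite !bisumE addrC. Qed.
Lemma tens_add0 : left_id tens_zero tens_add.
Proof. by move=> x; apply: tens_eqP => X f; rewrite !bisumE add0r. Qed.
Lemma tens_addN : left_inverse tens_zero tens_opp tens_add.
Proof.
by move=> x; apply: tens_eqP => X f; rewrite !bisumE scaleN1r addNr.
Qed.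

HB.instance Definition _ :=
  GRing.isZmodule.Build tens tens_addA tens_addC tens_add0 tens_addN.

Lemma tens_scaleA a b (x : tens) :
  tens_scale a (tens_scale b x) = tens_scale (a * b) x.
Proof. by apply: tens_eqP => X f; rewrite !bisumE scalerA. Qed.
Lemma tens_scale1 : left_id 1 tens_scale.
Proof. by move=> x; apply: tens_eqP => X f; rewrite !bisumE scale1r. Qed.
Lemma tens_scaleDr : right_distributive tens_scale +%R.
Proof. by move=> a x y; apply: tens_eqP => X f; rewrite !bisumE scalerDr. Qed.
Lemma tens_scaleDl (x : tens) :
  {morph tens_scale^~ x : a b / a + b >-> a + b}.
Proof. by move=> a b; apply: tens_eqP => X f; rewrite !bisumE scalerDl. Qed.

HB.instance Definition _ := GRing.Zmodule_isLmodule.Build k tens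
  tens_scaleA tens_scale1 tens_scaleDr tens_scaleDl.

Definition ptens (v : V) (w : W) : tens := tens_of [:: (v, w)].

Lemma bisum_ptens X (f : {bilinear V -> W -> X}) v w :
  bisum f (repr (ptens v w)) = f v w.
Proof. by rewrite bisum_repr /bisum big_seq1. Qed.

Lemma ptens_bilinear : bilin ptens.
Proof.
split=> [w|v] a u u' /=; apply: tens_eqP => X f.
- by rewrite (bisum_add f (a *: ptens u w)) bisum_scaler !bisum_ptens linearPl.
- by rewrite (bisum_add f (a *: ptens v u)) bisum_scaler !bisum_ptens linearPr.
Qed.

HB.instance Definition _ :=
  bilinear_isBilinear.Build k V W tens _ _ ptens ptens_bilinear.

Section Lift.
Variables (X : lmodType k) (f : {bilinear V -> W -> X}).

Definition tlift (t : tens) : X := bisum f (repr t).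

Lemma tlift_linear : linear tlift.
Proof.
by move=> a x y; rewrite /tlift (bisum_add f (a *: x)) bisum_scaler.
Qed.

HB.instance Definition _ :=
  GRing.isLinear.Build k tens X _ tlift tlift_linear.

Lemma tliftE v w : tlift (ptens v w) = f v w.
Proof. exact: bisum_ptens. Qed.

End Lift.

Lemma tens_sum (t : tens) : t = \sum_(p <- repr t) ptens p.1 p.2.
Proof.
apply: tens_eqP => X f.
rewrite -[RHS]/(tlift f (\sum_(p <- repr t) ptens p.1 p.2)) linear_sum.
by apply: eq_bigr => p _; rewrite /= tliftE.
Qed.

Lemma tens_ext (X : lmodType k) (f g : {linear tens -> X}) :
  (forall v w, f (ptens v w) = g (ptens v w)) -> f =1 g.
Proof.
move=> fg t; rewrite (tens_sum t) !linear_sum.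
by apply: eq_bigr => p _; rewrite fg.
Qed.

End Tensor.

Arguments ptens {k V W} & v w.

Notation "V \ox W" := (tens V W) : type_scope.
Notation "v \ot w" := (ptens v w) : ring_scope.

Section TensorMaps.
Variable k : fieldType.
Implicit Types U V W : lmodType k.

Definition idl V : {linear V -> V} := idfun.

Section Map.
Variables (V V' W W' : lmodType k).
Variables (f : {linear V -> V'}) (g : {linear W -> W'}).

Definition tmap_fun (v : V) (w : W) : V' \ox W' := f v \ot g w.

Lemma tmap_bilinear : bilin tmap_fun.
Proof.
by split=> [w|v] a u u' /=; rewrite /tmap_fun linearP ?linearPl ?linearPr.
Qed.

HB.instance Definition _ :=
  bilinear_isBilinear.Build k V W (V' \ox W') _ _ tmap_fun tmap_bilinear.

Definition tmap : {linear V \ox W -> V' \ox W'} := tlift tmap_fun.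

Lemma tmapE v w : tmap (v \ot w) = f v \ot g w.
Proof. exact: tliftE. Qed.

End Map.

Section Assoc.
Variables U V W : lmodType k.

Definition tassoc1_fun (w : W) (u : U) (v : V) : U \ox (V \ox W) :=
  u \ot (v \ot w).
Lemma tassoc1_bilinear w : bilin (tassoc1_fun w).
Proof.
split=> [v|u] a x y /=; rewrite /tassoc1_fun; first by rewrite linearPl.
by rewrite linearPl linearPr.
Qed.
HB.instance Definition _ w := bilinear_isBilinear.Build k U V
  (U \ox (V \ox W)) _ _ (tassoc1_fun w) (tassoc1_bilinear w).

Definition tassoc2_fun (t : U \ox V) (w : W) : U \ox (V \ox W) :=
  tlift (tassoc1_fun w) t.
Lemma tassoc2_bilinear : bilin tassoc2_fun.
Proof.
split=> [w|t] a x y /=; rewrite /tassoc2_fun; first by rewrite linearP.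
rewrite /tlift /bisum scaler_sumr -big_split.
by apply: eq_bigr => p _; rewrite /= /tassoc1_fun !linearPr.
Qed.
HB.instance Definition _ := bilinear_isBilinear.Build k (U \ox V) W
  (U \ox (V \ox W)) _ _ tassoc2_fun tassoc2_bilinear.

Definition tassoc : {linear (U \ox V) \ox W -> U \ox (V \ox W)} :=
  tlift tassoc2_fun.

Lemma tassocE u v w : tassoc ((u \ot v) \ot w) = u \ot (v \ot w).
Proof. by rewrite /tassoc /= tliftE /= /tassoc2_fun tliftE. Qed.

Definition tassocV1_fun (u : U) (v : V) (w : W) : (U \ox V) \ox W :=
  (u \ot v) \ot w.
Lemma tassocV1_bilinear u : bilin (tassocV1_fun u).
Proof.
split=> [w|v] a x y /=; rewrite /tassocV1_fun; last by rewrite linearPr.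
by rewrite linearPr linearPl.
Qed.
HB.instance Definition _ u := bilinear_isBilinear.Build k V W
  ((U \ox V) \ox W) _ _ (tassocV1_fun u) (tassocV1_bilinear u).

Definition tassocV2_fun (u : U) (t : V \ox W) : (U \ox V) \ox W :=
  tlift (tassocV1_fun u) t.
Lemma tassocV2_bilinear : bilin tassocV2_fun.
Proof.
split=> [t|u] a x y /=; rewrite /tassocV2_fun; last by rewrite linearP.
rewrite /tlift /bisum scaler_sumr -big_split.
by apply: eq_bigr => p _; rewrite /= /tassocV1_fun !linearPl.
Qed.
HB.instance Definition _ := bilinear_isBilinear.Build k U (V \ox W)
  ((U \ox V) \ox W) _ _ tassocV2_fun tassocV2_bilinear.

Definition tassocV : {linear U \ox (V \ox W) -> (U \ox V) \ox W} :=
  tlift tassocV2_fun.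

Lemma tassocVE u v w : tassocV (u \ot (v \ot w)) = (u \ot v) \ot w.
Proof. by rewrite /tassocV /= tliftE /= /tassocV2_fun tliftE. Qed.

End Assoc.

Section Units.
Variable V : lmodType k.

Definition tunitl_fun (a : k^o) (v : V) : V := a *: v.
Lemma tunitl_bilinear : bilin tunitl_fun.
Proof.
split=> [v|b] a x y /=; rewrite /tunitl_fun; first by rewrite scalerDl scalerA.
by rewrite scalerDr !scalerA mulrC.
Qed.
HB.instance Definition _ :=
  bilinear_isBilinear.Build k k^o V V _ _ tunitl_fun tunitl_bilinear.
Definition tunitl : {linear k^o \ox V -> V} := tlift tunitl_fun.
Lemma tunitlE a v : tunitl (a \ot v) = a *: v.
Proof. exact: tliftE. Qed.

Definition tunitr_fun (v : V) (a : k^o) : V := a *: v.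
Lemma tunitr_bilinear : bilin tunitr_fun.
Proof.
split=> [b|v] a x y /=; rewrite /tunitr_fun; last by rewrite scalerDl scalerA.
by rewrite scalerDr !scalerA mulrC.
Qed.
HB.instance Definition _ :=
  bilinear_isBilinear.Build k V k^o V _ _ tunitr_fun tunitr_bilinear.
Definition tunitr : {linear V \ox k^o -> V} := tlift tunitr_fun.
Lemma tunitrE v a : tunitr (v \ot a) = a *: v.
Proof. exact: tliftE. Qed.

End Units.

Section Mul.
Variable A : pzAlgebra k.

Definition tmul_fun (u v : A) : A := u * v.
Lemma tmul_bilinear : bilin tmul_fun.
Proof.
split=> [v|u] a x y /=; rewrite /tmul_fun.
- by rewrite mulrDl -pzscalerAl.
- by rewrite mulrDr -pzscalerAr.
Qed.
HB.instance Definition _ :=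
  bilinear_isBilinear.Build k A A A _ _ tmul_fun tmul_bilinear.
Definition tmul : {linear A \ox A -> A} := tlift tmul_fun.
Lemma tmulE u v : tmul (u \ot v) = u * v.
Proof. exact: tliftE. Qed.

End Mul.

(* The composites (s (x) Y) (X (x) t), (V (x) t) (s (x) W) and
   A (x) s (x) C, with the associativity constraints written out. *)

Definition pass_left X Y V V1 V2
    (s : {linear X \ox V1 -> V2 \ox X}) (t : {linear Y \ox V -> V1 \ox Y}) :
    {linear (X \ox Y) \ox V -> V2 \ox (X \ox Y)} :=
  tassoc V2 X Y \o tmap s (idl Y) \o tassocV X V1 Y \o tmap (idl X) t
    \o tassoc X Y V.

Definition pass_right X V W
    (s : {linear X \ox V -> V \ox X}) (t : {linear X \ox W -> W \ox X}) :
    {linear X \ox (V \ox W) -> (V \ox W) \ox X} :=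
  tassocV V W X \o tmap (idl V) t \o tassoc V X W \o tmap s (idl W)
    \o tassocV X V W.

Definition tmid A X Y X' Y' C (s : {linear X \ox Y -> Y' \ox X'}) :
    {linear (A \ox X) \ox (Y \ox C) -> (A \ox Y') \ox (X' \ox C)} :=
  tassocV A Y' (X' \ox C)
    \o tmap (idl A) (tassoc Y' X' C \o tmap s (idl C) \o tassocV X Y C)
    \o tassoc A X (Y \ox C).

Lemma pass_leftE X Y V V1 V2
    (s : {linear X \ox V1 -> V2 \ox X}) (t : {linear Y \ox V -> V1 \ox Y})
    x y v v1 y1 v2 x2 :
  t (y \ot v) = v1 \ot y1 -> s (x \ot v1) = v2 \ot x2 ->
  pass_left s t ((x \ot y) \ot v) = v2 \ot (x2 \ot y1).
Proof.
by move=> ht hs; rewrite /pass_left /= tassocE tmapE ht tassocVE tmapE hs tassocE.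
Qed.

Lemma pass_rightE X V W
    (s : {linear X \ox V -> V \ox X}) (t : {linear X \ox W -> W \ox X})
    x v w v1 x1 w2 x2 :
  s (x \ot v) = v1 \ot x1 -> t (x1 \ot w) = w2 \ot x2 ->
  pass_right s t (x \ot (v \ot w)) = (v1 \ot w2) \ot x2.
Proof.
move=> hs ht; rewrite /pass_right /=.
by rewrite tassocVE tmapE hs tassocE tmapE ht tassocVE.
Qed.

Lemma tmidE A X Y X' Y' C (s : {linear X \ox Y -> Y' \ox X'}) a x y c y1 x1 :
  s (x \ot y) = y1 \ot x1 ->
  tmid A C s ((a \ot x) \ot (y \ot c)) = (a \ot y1) \ot (x1 \ot c).
Proof.
move=> hs; rewrite /tmid /=.
by rewrite tassocE tmapE /= tassocVE tmapE hs tassocE tassocVE.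
Qed.

End TensorMaps.

Notation "f \om g" := (tmap f g) : ring_scope.

(* Composites such as s \o (f \om g) are compared pointwise; the identity of V
   in a tensor product of maps is [idl V]. *)

Record braided_bialgebra (k : fieldType) (H : pzAlgebra k)
    (comul : {linear H -> H \ox H}) (counit : {linear H -> k^o})
    (braid : {linear H \ox H -> H \ox H}) : Prop := IsBraidedBialgebra {
  bb_coassoc : tassoc H H H \o (comul \om idl H) \o comul
    =1 (idl H \om comul) \o comul;
  bb_counitl : tunitl H \o (counit \om idl H) \o comul =1 id;
  bb_counitr : tunitr H \o (idl H \om counit) \o comul =1 id;
  bb_braid_bij : bijective braid;
  bb_yang_baxter : pass_left braid braid \o (braid \om idl H)
    =1 (idl H \om braid) \o pass_left braid braid;
  bb_braid1l : forall h : H, braid (1 \ot h) = h \ot 1;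
  bb_braid1r : forall h : H, braid (h \ot 1) = 1 \ot h;
  bb_braidMl : braid \o (tmul H \om idl H)
    =1 (idl H \om tmul H) \o pass_left braid braid;
  bb_braidMr : braid \o (idl H \om tmul H)
    =1 (tmul H \om idl H) \o pass_right braid braid;
  bb_braid_counitl : tunitr H \o (idl H \om counit) \o braid
    =1 tunitl H \o (counit \om idl H);
  bb_braid_counitr : tunitl H \o (counit \om idl H) \o braid
    =1 tunitr H \o (idl H \om counit);
  bb_braid_comull : (idl H \om comul) \o braid
    =1 pass_left braid braid \o (comul \om idl H);
  bb_braid_comulr : (comul \om idl H) \o braid
    =1 pass_right braid braid \o (idl H \om comul);
  bb_comul1 : comul 1 = 1 \ot 1;
  bb_comulM : comul \o tmul H
    =1 (tmul H \om tmul H) \o tmid H H braid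
       \o (comul \om comul);
  bb_counit1 : counit 1 = 1;
  bb_counitM : forall h l : H, counit (h * l) = counit h * counit l
}.

Record braidedBialgebra (k : fieldType) := BraidedBialgebra {
  bb_alg :> pzAlgebra k;
  comul : {linear bb_alg -> bb_alg \ox bb_alg};
  counit : {linear bb_alg -> k^o};
  braid : {linear bb_alg \ox bb_alg -> bb_alg \ox bb_alg};
  bb_axioms : braided_bialgebra comul counit braid
}.

Definition has_antipode (k : fieldType) (H : braidedBialgebra k) : Prop :=
  exists S : {linear H -> H},
    (forall h, tmul H ((S \om idl H) (comul H h)) = (counit H h : k) *: (1 : H)) /\
    (forall h, tmul H ((idl H \om S) (comul H h)) = (counit H h : k) *: (1 : H)).

Section ComoduleAlgebra.
Variables (k : fieldType) (H : braidedBialgebra k).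

Record left_space (V : lmodType k) (s : {linear H \ox V -> V \ox H}) : Prop :=
  LeftSpace {
  ls_bij : bijective s;
  ls_one : forall v, s (1 \ot v) = v \ot 1;
  ls_mul : s \o (tmul H \om idl V) =1 (idl V \om tmul H) \o pass_left s s;
  ls_counit : tunitr V \o (idl V \om counit H) \o s
    =1 tunitl V \o (counit H \om idl V);
  ls_comul : (idl V \om comul H) \o s =1 pass_left s s \o (comul H \om idl V);
  ls_braid : pass_left s s \o (braid H \om idl V)
    =1 (idl V \om braid H) \o pass_left s s
}.

Variable B : pzAlgebra k.

Record left_transposition (s : {linear H \ox B -> B \ox H}) : Prop :=
  LeftTransposition {
  lt_space : left_space s;
  lt_one : forall h, s (h \ot 1) = 1 \ot h;
  lt_mul : s \o (idl H \om tmul B) =1 (tmul B \om idl H) \o pass_right s s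
}.

Record right_comodule (nu : {linear B -> B \ox H}) : Prop := RightComodule {
  rc_coassoc : tassoc B H H \o (nu \om idl H) \o nu
    =1 (idl B \om comul H) \o nu;
  rc_counit : tunitr B \o (idl B \om counit H) \o nu =1 id
}.

Record right_comodule_algebra (s : {linear H \ox B -> B \ox H})
    (nu : {linear B -> B \ox H}) : Prop := RightComoduleAlgebra {
  ca_comodule : right_comodule nu;
  ca_transposition : left_transposition s;
  ca_compat : (nu \om idl H) \o s
    =1 pass_right s (braid H) \o (idl H \om nu);
  ca_mul : nu \o tmul B =1 (tmul B \om tmul H) \o tmid B H s \o (nu \om nu);
  ca_one : nu 1 = 1 \ot 1
}.

End ComoduleAlgebra.

Section Datum.
Variables (k : fieldType) (G : finGroupType) (chi : G -> k) (z : G).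

Definition qint (t : k) (j : nat) : k := \sum_(i < j) t ^+ i.
Definition qfact (t : k) (j : nat) : k := \prod_(1 <= i < j.+1) qint t i.

Definition aut_chiz : {set {perm G}} :=
  [set phi in Aut [set: G] | (phi z == z) && [forall g, chi (phi g) == chi g]].

Lemma aut_chiz_group_set : group_set aut_chiz.
Proof.
apply/group_setP; split=> [|s t].
  by rewrite inE group1 perm1 eqxx; apply/forallP=> g; rewrite perm1.
move=> /setIdP[sA /andP[/eqP sz /forallP sc]].
move=> /setIdP[tA /andP[/eqP tz /forallP tc]].
rewrite inE groupM // permM sz tz eqxx /=; apply/forallP=> g.
by rewrite permM (eqP (tc _)) (eqP (sc _)).
Qed.
Canonical aut_chiz_group := Group aut_chiz_group_set.

(* Permutations multiply in diagrammatic order, (s * t) g = t (s g), so that the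
   second component of [gop_mul] is the composite of [v.2] after [u.2]. *)

Definition gop : Type := (G * [subg aut_chiz])%type.
HB.instance Definition _ := Finite.on gop.

Definition gop_mul (u v : gop) : gop :=
  ((sgval v.2 u.1 * v.1)%g, (u.2 * v.2)%g).
Definition gop_one : gop := (1%g, 1%g).
Definition gop_inv (u : gop) : gop :=
  ((sgval (u.2^-1) (u.1^-1))%g, (u.2^-1)%g).

Lemma aut_chizM (s : [subg aut_chiz]) (g h : G) :
  sgval s (g * h)%g = (sgval s g * sgval s h)%g.
Proof.
have := subgP s; rewrite inE => /andP[/Aut_morphic /morphicP sM _].
by rewrite sM ?inE.
Qed.

Lemma gop_mulA : associative gop_mul.
Proof.
move=> u v w; congr (_, _); last by rewrite /= mulgA.
by rewrite /= permM aut_chizM mulgA.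
Qed.
Lemma gop_mul1 : left_id gop_one gop_mul.
Proof.
case=> g s; rewrite /gop_mul /= mul1g; congr (_, _).
suff -> : sgval s 1%g = 1%g by rewrite mul1g.
by apply: (mulIg (sgval s 1%g)); rewrite -aut_chizM !mul1g.
Qed.
Lemma gop_mulV : left_inverse gop_one gop_inv gop_mul.
Proof.
case=> g s; rewrite /gop_mul /gop_inv /gop_one /= mulVg; congr (_, _).
by rewrite permKV mulVg.
Qed.
HB.instance Definition _ :=
  Finite_isGroup.Build gop gop_mulA gop_mul1 gop_mulV.

Variables (lam q : k) (n : nat).

(* lam (z^n - 1) != 0 in the group algebra, where z^n and 1 are basis
   elements. *)
Definition twisted : bool := (lam != 0) && (z ^+ n != 1)%g.

Record hopf_datum : Prop := HopfDatum {
  hd_chi_neq0 : forall g, chi g != 0;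
  hd_chiM : {morph chi : g h / (g * h)%g >-> g * h};
  hd_central : forall g, commute z g;
  hd_q_neq0 : q != 0;
  hd_n_gt1 : (1 < n)%N;
  hd_order : n.-primitive_root (q * chi z);
  hd_twisted : twisted -> forall g, chi g ^+ n = 1
}.

(* By the relations every word in G and x is a combination of the g x^i with
   i < n; as these are linearly independent in H, the algebra H is the one
   presented by these generators and relations. *)
Record is_HD (H : braidedBialgebra k) (gr : G -> H) (x : H) : Prop := IsHD {
  HD_one : gr 1%g = 1;
  HD_mul : {morph gr : g h / (g * h)%g >-> g * h};
  HD_xn : x ^+ n = lam *: (gr (z ^+ n)%g - 1);
  HD_xg : forall g, x * gr g = chi g *: (gr g * x);
  HD_basis : forall h : H, exists! f : {ffun G * 'I_n -> k},
    h = \sum_u f u *: (gr u.1 * x ^+ u.2);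
  HD_comul_g : forall g, comul H (gr g) = gr g \ot gr g;
  HD_comul_x : comul H x = (1 \ot x : H \ox H) + x \ot gr z;
  HD_counit_g : forall g, counit H (gr g) = 1;
  HD_counit_x : counit H x = 0;
  HD_braid : forall g h i j, (i < n)%N -> (j < n)%N ->
    braid H ((gr g * x ^+ i) \ot (gr h * x ^+ j)) =
      q ^+ (i * j) *: ((gr h * x ^+ j) \ot (gr g * x ^+ i));
  HD_antipode : has_antipode H
}.

Section Gradation.
Variable B : pzAlgebra k.

Definition subspace (S : set B) : Prop :=
  [/\ S 0, forall u v, S u -> S v -> S (u + v) & forall a u, S u -> S (a *: u)].

Definition gradation (I : finType) (D : I -> set B) : Prop :=
  (forall i, subspace (D i)) /\
  forall b, exists! f : {ffun I -> B}, (forall i, D i (f i)) /\ b = \sum_i f i.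

Definition part (I : finType) (D : I -> set B) (P : pred I) : set B :=
  [set b | exists f : {ffun I -> B},
     (forall i, D i (f i)) /\ b = \sum_(i | P i) f i].

Definition component (I : finType) (D : I -> set B) (b : B) (i : I) (c : B) :
    Prop :=
  exists f : {ffun I -> B},
    [/\ forall j, D j (f j), b = \sum_j f j & f i = c].

Variables (D : gop -> set B) (alpha U : B -> B).

Definition part_grp (g : G) : set B := part D (fun d => d.1 == g).
Definition part_aut (zeta : [subg aut_chiz]) : set B :=
  part D (fun d => d.2 == zeta).

Definition algebra_gradation : Prop :=
  D 1%g 1 /\
  forall d e b c, D d b -> D e c -> D (d * e)%g (b * c).

Definition shift (d : gop) : gop := ((z ^- n * d.1)%g, d.2).

Definition twisted_term (h : G) (b c : B) : B :=
  - lam *: \sum_(1 <= j < n)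
     (chi z ^+ (j ^ 2) * chi h ^+ j
        / (qfact (q * chi z) j * qfact (q * chi z) (n - j)))
     *: (iter j U b * iter j alpha (iter (n - j) U c)).

Definition compatible : Prop :=
  if twisted then
    [/\ D 1%g 1,
        forall d e b c, D d b -> D e c ->
          part D (pred2 (d * e)%g (shift (d * e)%g)) (b * c)
      & forall d e b c, D d b -> D e c ->
          component D (b * c) (shift (d * e)%g) (twisted_term e.1 b c)]
  else algebra_gradation.

End Gradation.

Record comodule_data (B : pzAlgebra k) (D : gop -> set B)
    (alpha U : {linear B -> B}) : Prop := ComoduleData {
  cd_gradation : gradation D;
  cd_alpha_mul : monoid_morphism alpha;
  cd_alpha_bij : bijective alpha;
  cd_alpha_order : twisted -> iter n alpha =1 id;
  cd_alpha_graded : forall d, (alpha @` D d)%classic = D d;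
  cd_compatible : compatible D alpha U;
  cd_U_alpha : forall b, U (alpha b) = q *: alpha (U b);
  cd_U_nilp : forall b, iter n U b = 0;
  cd_U_graded : forall d b, D d b -> D ((z^-1 * d.1)%g, d.2) (U b);
  cd_U_mul : forall b h c, part_grp D h c ->
    U (b * c) = b * U c + chi h *: (U b * alpha c)
}.

Section Formulas.
Variables (H : braidedBialgebra k) (gr : G -> H) (x : H) (B : pzAlgebra k).
Variables (D : gop -> set B) (alpha U : {linear B -> B}).

Definition transposition_formula (s : {linear H \ox B -> B \ox H}) : Prop :=
  forall g i zeta b, (i < n)%N -> part_aut D zeta b ->
    s ((gr g * x ^+ i) \ot b) = iter i alpha b \ot (gr (sgval zeta g) * x ^+ i).

Definition coaction_formula (nu : {linear B -> B \ox H}) : Prop :=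
  forall g b, part_grp D g b ->
    nu b = \sum_(i < n) (qfact (q * chi z) i)^-1 *:
             (iter i U b \ot (gr (z ^- i * g)%g * x ^+ i)).

End Formulas.
End Datum.

(* Main.v *)
Require Import Defs.
From HB Require Import structures.
From mathcomp Require Import all_boot all_order all_algebra all_fingroup.
From mathcomp Require Import sesquilinear.
From mathcomp Require Import ring.
From mathcomp Require Import boolp classical_sets.

Set Implicit Arguments.
Unset Strict Implicit.
Unset Printing Implicit Defensive.

Import GRing.Theory.
Local Open Scope ring_scope.

(* All the identities are compared on the basis g x^i of H and on homogeneous
   elements of B. The heart of both directions is the formula for the product of
   coactions: for b of degree (g, zeta) and c of degree (h, phi), nu(b) nu(c) is
   the sum over m < 2n of S_m (x) z^-m phi(g) h x^m, where
   S_m = sum_(i + j = m) chi(z^-j h)^i / ((i)! (j)!) U^i(b) alpha^i(U^j(c)).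
   The relation x^n = lambda (z^n - 1) folds the terms with m >= n back, and this
   is what forces the component of bc in degree z^-n phi(g) h to be -lambda S_n.
   Conversely, when U is a skew derivation, U(S_m) = (m + 1) S_(m + 1), so that
   U^m(S_l) = (m)! S_(l + m) for l = 0 and l = n, because (qp)^n = 1.

   To classify the structures, the coefficients of s(g (x) -), s(x (x) -) and nu
   in the basis of H are read as endomorphisms of B. The comultiplication axioms
   make the group-like coefficients orthogonal idempotents, and the braid axiom
   makes coefficients commute up to powers of q. The point is that
   s(x (x) b) = alpha(b) (x) x without a component in k[G]: if p = 1 then the
   q-commutations and q^2 <> 1 put the image of such a component in the kernel of
   s, while if p <> 1 it is ruled out by the relation x z = p z x. *)

(** * Linear algebra *)

Section Spanning.
Variable k : fieldType.
Implicit Types V W X : lmodType k.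

Inductive lspan V (S : V -> Prop) : V -> Prop :=
| lspan0 : lspan S 0
| lspanP a u v : S u -> lspan S v -> lspan S (a *: u + v).

Definition spanning V (S : V -> Prop) := forall v, lspan S v.

(** Separating sums from multiples lets a linear identity be checked on generators without bundling
    its two sides as linear maps. *)
Lemma lspan_ind2 V (S P : V -> Prop) :
  P 0 -> (forall u v, P u -> P v -> P (u + v)) ->
  (forall a u, P u -> P (a *: u)) -> (forall u, S u -> P u) ->
  forall v, lspan S v -> P v.
Proof. by move=> P0 PD PZ PS v; elim=> // a u w /PS/(PZ a) Pu _ /(PD _ _ Pu). Qed.

Lemma lspan_gen V (S : V -> Prop) u : S u -> lspan S u.
Proof. by move=> Su; rewrite -[u]addr0 -[u]scale1r; apply/lspanP/lspan0. Qed.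

Lemma lspanD V (S : V -> Prop) u v :
  lspan S u -> lspan S v -> lspan S (u + v).
Proof.
by elim=> [|a w u' Sw _ ih] Sv; rewrite ?add0r // -addrA; apply/lspanP/ih.
Qed.

Lemma lspanZ V (S : V -> Prop) a u : lspan S u -> lspan S (a *: u).
Proof.
elim=> [|b w v Sw _ ih]; first by rewrite scaler0; apply: lspan0.
by rewrite scalerDr scalerA; apply: lspanP.
Qed.

Lemma lspan_sum V (S : V -> Prop) (I : Type) (r : seq I) (P : pred I)
    (F : I -> V) :
  (forall i, P i -> lspan S (F i)) -> lspan S (\sum_(i <- r | P i) F i).
Proof. by move=> h; elim/big_ind: _ => //; [apply: lspan0|apply: lspanD]. Qed.

Lemma lspan_sub V (S T : V -> Prop) u :
  (forall v, S v -> lspan T v) -> lspan S u -> lspan T u.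
Proof.
move=> ST; apply: lspan_ind2 => //;
  [exact: lspan0|exact: lspanD|exact: lspanZ].
Qed.

Lemma lin_ext V X (S : V -> Prop) (f g : {linear V -> X}) :
  spanning S -> (forall v, S v -> f v = g v) -> f =1 g.
Proof.
move=> sS fg v; elim: (sS v) => [|a u w Su _ ih]; first by rewrite !linear0.
by rewrite !linearP fg ?ih.
Qed.

Definition ptens_set V W (S : V -> Prop) (T : W -> Prop) (t : V \ox W) :=
  exists v w, [/\ S v, T w & t = v \ot w].

Lemma spanning_tens V W (S : V -> Prop) (T : W -> Prop) :
  spanning S -> spanning T -> spanning (ptens_set S T).
Proof.
move=> sS sT t; rewrite (tens_sum t); apply: lspan_sum => -[v w] _ /=.
elim: (sS v) => [|a u v' Su _ ih]; first by rewrite linear0l; apply: lspan0.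
rewrite linearPl; apply: lspanD ih; apply: lspanZ.
elim: (sT w) => [|b y w' Ty _ ih]; first by rewrite linear0r; apply: lspan0.
by rewrite linearPr; apply: lspanP ih; exists u, y.
Qed.

Lemma spanning_full V : spanning (fun _ : V => True).
Proof. by move=> v; apply: lspan_gen. Qed.

(** A sigma type rather than an existential, so that definitions can extract the bundled map by
    [sval]. As the proof is opaque, such a map is known only through its pointwise equation. *)
Lemma linear_map V X (f : V -> X) :
  linear f -> {F : {linear V -> X} | F =1 f}.
Proof.
move=> hf; pose m := GRing.isLinear.Build k V X *:%R f hf.
pose F : {linear V -> X} := HB.pack f m.
by exists F.
Qed.

Lemma linear_bigsum V X (I : Type) (r : seq I) (P : pred I) (F : I -> V -> X) :
  (forall i, linear (F i)) -> linear (fun v => \sum_(i <- r | P i) F i v).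
Proof.
move=> hF a u v; rewrite scaler_sumr -big_split.
by apply: eq_bigr => i _; rewrite hF.
Qed.

Lemma iter_linear V (f : {linear V -> V}) i : linear (iter i f).
Proof. by elim: i => [|i ih] a u v //=; rewrite ih linearP. Qed.

Lemma iter_linear0 V (f : {linear V -> V}) i : iter i f 0 = 0.
Proof. by elim: i => //= i ->; rewrite linear0. Qed.

Lemma tensor_map V W X (f : V -> W -> X) :
  (forall w, linear (f^~ w)) -> (forall v, linear (f v)) ->
  {F : {linear V \ox W -> X} | forall v w, F (v \ot w) = f v w}.
Proof.
move=> hl hr.
have hf : bilinear_for (GRing.Scale.Law.clone _ _ *:%R _)
  (GRing.Scale.Law.clone _ _ *:%R _) f by split.
pose m := bilinear_isBilinear.Build k V W X *:%R *:%R f hf.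
pose F : {bilinear V -> W -> X} := HB.pack f m.
by exists (tlift F) => v w; exact: tliftE.
Qed.

End Spanning.
Section PassTensors.
Variables (k : fieldType) (X Y V W : lmodType k).

(** Unlike [pass_leftE], this applies when the inner transposition does not return a pure tensor,
    the situation met before a structure has been classified. *)
Lemma pass_left_tens V1 V2
    (s : {linear X \ox V1 -> V2 \ox X}) (t : {linear Y \ox V -> V1 \ox Y}) x y v :
  pass_left s t ((x \ot y) \ot v) =
  tassoc V2 X Y ((s \om idl Y) (tassocV X V1 Y (x \ot t (y \ot v)))).
Proof. by rewrite /pass_left /= tassocE tmapE. Qed.

Lemma pass_right_tens
    (s : {linear X \ox V -> V \ox X}) (t : {linear X \ox W -> W \ox X}) x v w :
  pass_right s t (x \ot (v \ot w)) =
  tassocV V W X ((idl V \om t) (tassoc V X W (s (x \ot v) \ot w))).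
Proof. by rewrite /pass_right /= tassocVE tmapE. Qed.

End PassTensors.

(** * Vector space gradations and their projections *)

Section Gradations.
Variables (k : fieldType) (B : pzAlgebra k) (I : finType) (D : I -> set B).

Section Subspaces.
Hypothesis Dsub : forall i, subspace (D i).

Lemma grad0 i : D i 0. Proof. by case: (Dsub i). Qed.
Lemma gradD i u v : D i u -> D i v -> D i (u + v).
Proof. by case: (Dsub i) => _ h _; apply: h. Qed.
Lemma gradZ i a u : D i u -> D i (a *: u).
Proof. by case: (Dsub i) => _ _; apply. Qed.
End Subspaces.

Section Projections.
Hypothesis gD : gradation D.

Definition gcomp (b : B) : {ffun I -> B} := sval (cid (gD.2 b)).

Lemma gcomp_in b i : D i (gcomp b i).
Proof. by rewrite /gcomp; case: cid => f /= [[]]. Qed.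

Lemma gcomp_sum b : b = \sum_i gcomp b i.
Proof. by rewrite /gcomp; case: cid => f /= [[]]. Qed.

Lemma gcomp_uniq b f : (forall i, D i (f i)) -> b = \sum_i f i ->
  forall i, gcomp b i = f i.
Proof.
move=> Df bf i; rewrite /gcomp; case: cid => f' /= [_ uf].
rewrite (uf [ffun i => f i]) ?ffunE //; split=> [j|]; first by rewrite ffunE.
by rewrite bf; apply: eq_bigr => j _; rewrite ffunE.
Qed.

Lemma gcomp_linear i : linear (fun b => gcomp b i).
Proof.
move=> a u v; apply: (gcomp_uniq (f := fun j => a *: gcomp u j + gcomp v j)) => [j|].
  by apply: (gradD gD.1); [apply: (gradZ gD.1)|]; apply: gcomp_in.
rewrite {1}(gcomp_sum u) {1}(gcomp_sum v) scaler_sumr -big_split.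
by apply: eq_bigr.
Qed.

Definition gproj i : {linear B -> B} := sval (linear_map (gcomp_linear i)).

Lemma gprojE i b : gproj i b = gcomp b i.
Proof. by rewrite /gproj; case: linear_map => f /= ->. Qed.

Lemma gproj_in i b : D i (gproj i b).
Proof. by rewrite gprojE; apply: gcomp_in. Qed.

Lemma gproj_sum b : b = \sum_i gproj i b.
Proof. by rewrite [LHS]gcomp_sum; apply: eq_bigr => i _; rewrite gprojE. Qed.

Lemma gproj_id i j b : D j b -> gproj i b = if i == j then b else 0.
Proof.
move=> Db; rewrite gprojE.
apply: (gcomp_uniq (f := fun l => if l == j then b else 0)) => [l|].
  by case: eqP => [->|_] //; apply: (grad0 gD.1).
by rewrite -big_mkcond big_pred1_eq.
Qed.

(** Maps prescribed degree by degree are defined as sums over all projections; on a homogeneous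
    element only its own degree survives. *)
Lemma gproj_bigsum (X : zmodType) (F : I -> B -> X) j b :
  (forall i, F i 0 = 0) -> D j b -> \sum_i F i (gproj i b) = F j b.
Proof.
move=> F0 Db; rewrite (bigD1 j) //= (gproj_id _ Db) eqxx big1 ?addr0 // => i ij.
by rewrite (gproj_id _ Db) (negPf ij).
Qed.

Lemma part_sub (P Q : pred I) b :
  (forall i, P i -> Q i) -> part D P b -> part D Q b.
Proof.
move=> PQ [f [Df bf]]; exists [ffun i => if P i then f i else 0]; split=> [i|].
  by rewrite ffunE; case: ifP => _ //; apply: (grad0 gD.1).
rewrite bf big_mkcond [RHS]big_mkcond; apply: eq_bigr => i _; rewrite ffunE.
by case: ifP => [/PQ ->|_] //; case: ifP.
Qed.

Lemma spanning_grad : spanning (fun b => exists i, D i b).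
Proof.
move=> b; rewrite (gproj_sum b); apply: lspan_sum => i _.
by apply: lspan_gen; exists i; apply: gproj_in.
Qed.

Lemma part_gproj (P : pred I) b : part D P b <-> b = \sum_(i | P i) gproj i b.
Proof.
split=> [[f [Df bf]]|bP]; last first.
  exists [ffun i => gproj i b]; split=> [i|]; first by rewrite ffunE; apply: gproj_in.
  by rewrite {1}bP; apply: eq_bigr => i _; rewrite ffunE.
have gb i : gproj i b = if P i then f i else 0.
  rewrite gprojE; apply: (gcomp_uniq (f := fun i => if P i then f i else 0)) => [j|].
    by case: ifP => _ //; apply: (grad0 gD.1).
  by rewrite bf big_mkcond.
by rewrite [LHS]bf; apply: eq_bigr => i Pi; rewrite gb Pi.
Qed.

Lemma part_in (P : pred I) i b : P i -> D i b -> part D P b.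
Proof.
move=> Pi Db; apply/part_gproj; rewrite (bigD1 i) //= big1 => [|j /andP[_ /negPf ji]].
  by rewrite (gproj_id _ Db) eqxx addr0.
by rewrite (gproj_id _ Db) ji.
Qed.

Lemma partD (P : pred I) u v : part D P u -> part D P v -> part D P (u + v).
Proof.
move=> /part_gproj Pu /part_gproj Pv; apply/part_gproj.
by rewrite {1}Pu {1}Pv -big_split; apply: eq_bigr => i _; rewrite linearD.
Qed.

Lemma component_gproj b i c : component D b i c <-> gproj i b = c.
Proof.
split=> [[f [Df bf <-]]|<-].
  by rewrite gprojE (gcomp_uniq Df bf).
exists [ffun j => gproj j b]; split=> [j||]; rewrite ?ffunE //.
- exact: gproj_in.
- by rewrite {1}(gproj_sum b); apply: eq_bigr => j _; rewrite ffunE.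
Qed.

Lemma part_ind (P : pred I) (R : B -> Prop) :
  R 0 -> (forall u v, R u -> R v -> R (u + v)) ->
  (forall i b, P i -> D i b -> R b) -> forall b, part D P b -> R b.
Proof.
move=> R0 RD RP b /part_gproj ->; elim/big_ind: _ => // i Pi.
by apply: (RP i) => //; apply: gproj_in.
Qed.

End Projections.

(** By linearity, the values on the spanning homogeneous elements show that [pr i] lands in [D i]
    and that the [pr i] add up to the identity; existence and uniqueness of the decomposition
    follow. *)
Lemma gradation_of_proj (pr : I -> {linear B -> B}) :
  (forall i, subspace (D i)) -> spanning (fun b => exists i, D i b) ->
  (forall i j b, D j b -> pr i b = if i == j then b else 0) -> gradation D.
Proof.
move=> Ds sD prD; split=> // b.
have pr_in i u : D i (pr i u).
  elim/lspan_ind2: (sD u) => {u} [|u v Du Dv|a u Du|u [j Du]].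
  - by rewrite linear0; apply: (grad0 Ds).
  - by rewrite linearD; apply: (gradD Ds).
  - by rewrite linearZ; apply: (gradZ Ds).
  - by rewrite (prD _ _ _ Du); case: eqP => [->|_] //; apply: (grad0 Ds).
have pr_sum u : u = \sum_i pr i u.
  elim/lspan_ind2: (sD u) => {u} [|u v Du Dv|a u Du|u [j Du]].
  - by rewrite big1 // => i _; rewrite linear0.
  - by rewrite {1}Du {1}Dv -big_split; apply: eq_bigr => i _; rewrite linearD.
  - by rewrite {1}Du scaler_sumr; apply: eq_bigr => i _; rewrite linearZ.
  - rewrite (bigD1 j) //= (prD _ _ _ Du) eqxx big1 ?addr0 // => i /negPf ij.
    by rewrite (prD _ _ _ Du) ij.
exists [ffun i => pr i b]; split=> [|f [Df bf]].
  split=> [i|]; first by rewrite ffunE; apply: pr_in.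
  by rewrite {1}(pr_sum b); apply: eq_bigr => i _; rewrite ffunE.
apply/ffunP=> i; rewrite ffunE bf linear_sum (bigD1 i) //= (prD _ _ _ (Df i)) eqxx.
by rewrite big1 ?addr0 // => j /negPf ji; rewrite (prD _ _ _ (Df j)) eq_sym ji.
Qed.

End Gradations.

(** Groups the terms by m = i + j. The vanishing off the square allows [i] to run over the whole
    range from 0 to m. *)
Lemma triangular_sum (n : nat) (V : zmodType) (F : nat -> nat -> V) :
  (forall i j, (n <= i)%N -> F i j = 0) -> (forall i j, (n <= j)%N -> F i j = 0) ->
  \sum_(i < n) \sum_(j < n) F i j = \sum_(m < n + n) \sum_(i < m.+1) F i (m - i)%N.
Proof.
move=> F1 F2.
transitivity (\sum_(i < n) \sum_(m < n + n | (i <= m)%N) F i (m - i)%N).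
  apply: eq_bigr => i _.
  rewrite -(big_mkord (fun m => i <= m)%N (fun m => F i (m - i)%N)).
  have iD : (i + n <= n + n)%N by rewrite leq_add2r ltnW.
  rewrite (big_cat_nat (n := i)) //=; last exact: leq_trans (leq_addr n i) iD.
  rewrite (big_cat_nat (leq_addr n i) iD) /=.
  rewrite [X in _ = X + _]big_nat_cond [X in _ = X + _]big1 ?add0r; last first.
    by move=> m /andP[/andP[_ mi]]; rewrite leqNgt mi.
  rewrite [X in _ = _ + X]big_nat_cond [X in _ = _ + X]big1 ?addr0; last first.
    by move=> m /andP[/andP[im _] _]; rewrite F2 // leq_subRL // (leq_trans (leq_addr n i)).
  have -> : \sum_(i <= m < i + n | (i <= m)%N) F i (m - i)%N = \sum_(0 <= j < n) F i j.
    rewrite -{1}(add0n i) (addnC i n) big_addn addnK.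
    by apply: eq_big => j; rewrite ?leq_addl ?addnK.
  by rewrite big_mkord.
rewrite (exchange_big_dep predT) //=; apply: eq_bigr => m _.
(* Both inner sums are extended to the common range [n + m.+1] before being compared; the terms with
   [i >= n] vanish. *)
rewrite (big_ord_widen_cond (n + m.+1) (fun i => i <= m)%N (fun i => F i (m - i)%N)) ?leq_addr //.
rewrite (big_ord_widen (n + m.+1) (fun i => F i (m - i)%N)) ?leq_addl //.
rewrite big_mkcond [RHS]big_mkcond; apply: eq_bigr => i _ /=; rewrite ltnS.
by case: (i <= m)%N => //=; case: ltnP => // /F1 ->.
Qed.


(** * Quantum integers and factorials at a root of unity *)

Section QFactorials.
Variables (k : fieldType) (n : nat) (t : k).
Hypotheses (n_gt1 : (1 < n)%N) (t_prim : n.-primitive_root t).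

Lemma qintD i j : qint t (i + j) = qint t i + t ^+ i * qint t j.
Proof.
rewrite /qint big_split_ord /= mulr_sumr; congr (_ + _).
by apply: eq_bigr => l _; rewrite exprD.
Qed.

Lemma qint1 : qint t 1 = 1.
Proof. by rewrite /qint big_ord1. Qed.

(** (t - 1) (j)_t = t^j - 1, and t differs from 1 because its order exceeds 1. *)
Lemma qint_eq0 j : (qint t j == 0) = (n %| j)%N.
Proof.
have t1 : t - 1 != 0.
  by rewrite subr_eq0 -(expr1 t) -(prim_order_dvd t_prim) dvdn1; case: n n_gt1 => [|[]].
by rewrite (prim_order_dvd t_prim) -(subr_eq0 (t ^+ j)) subrX1 mulf_eq0 (negPf t1).
Qed.

Lemma qfact0 : qfact t 0 = 1.
Proof. by rewrite /qfact big_geq. Qed.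

Lemma qfactS j : qfact t j.+1 = qfact t j * qint t j.+1.
Proof. by rewrite /qfact big_nat_recr. Qed.

Lemma qfact_neq0 j : (j < n)%N -> qfact t j != 0.
Proof.
elim: j => [|j ih] jn; first by rewrite qfact0 oner_eq0.
by rewrite qfactS mulf_neq0 ?ih ?qint_eq0 ?gtnNdvd // ltnW.
Qed.

Lemma qfact_eq0 j : (n <= j)%N -> qfact t j = 0.
Proof.
move/subnKC <-; elim: (j - n)%N => [|m ih]; last by rewrite addnS qfactS ih mul0r.
rewrite addn0 -(prednK (ltnW n_gt1)) qfactS (prednK (ltnW n_gt1)).
by apply/eqP; rewrite mulf_eq0 qint_eq0 dvdnn orbT.
Qed.

(** The Gaussian binomial coefficient of [i + j] over [i]; at a primitive n-th root of unity it
    vanishes for [i + j >= n], as its numerator does. *)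
Definition qbin (i j : nat) : k := qfact t (i + j) / (qfact t i * qfact t j).

Lemma qbin0l j : (j < n)%N -> qbin 0 j = 1.
Proof. by move=> jn; rewrite /qbin add0n qfact0 mul1r divff ?qfact_neq0. Qed.

Lemma qbin0r i : (i < n)%N -> qbin i 0 = 1.
Proof. by move=> jn; rewrite /qbin addn0 qfact0 mulr1 divff ?qfact_neq0. Qed.

(** The Pascal rule, from (i + j + 2)_t = (j + 1)_t + t^(j + 1) (i + 1)_t; the bounds keep the
    denominators nonzero. *)
Lemma qbinS i j : (i.+1 < n)%N -> (j.+1 < n)%N ->
  qbin i.+1 j.+1 = qbin i.+1 j + t ^+ j.+1 * qbin i j.+1.
Proof.
move=> /qfact_neq0 ni /qfact_neq0 nj.
rewrite /qbin !addnS !addSn !qfactS.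
have -> : (i + j).+2 = (j.+1 + i.+1)%N by rewrite addSn addnS addnC.
move: ni nj; rewrite ?qfactS !mulf_eq0 !negb_or => /andP[ni ni'] /andP[nj nj'].
rewrite qintD; field.
by rewrite ni ni' nj nj'.
Qed.

End QFactorials.

(** * The algebra H and coordinates in tensor products *)

Section HopfAlgebra.
Variables (k : fieldType) (G : finGroupType) (chi : G -> k) (z : G).
Variables (lam q : k) (n : nat) (hD : hopf_datum chi z lam q n).
Variables (H : braidedBialgebra k) (gr : G -> H) (x : H).
Hypothesis hH : is_HD chi z lam q n gr x.

Local Notation qp := (q * chi z).
Let n_gt1 := hd_n_gt1 hD.
Let n_gt0 := ltnW n_gt1.
Let qp_prim := hd_order hD.

Lemma chi1 : chi 1%g = 1.
Proof.
by apply: (mulIf (hd_chi_neq0 hD 1%g)); rewrite -(hd_chiM hD) mulg1 mul1r.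
Qed.

Lemma chiV g : chi g^-1%g = (chi g)^-1.
Proof.
apply: (mulIf (hd_chi_neq0 hD g)).
by rewrite -(hd_chiM hD) mulVg chi1 mulVf ?(hd_chi_neq0 hD).
Qed.

Lemma chiX g i : chi (g ^+ i)%g = chi g ^+ i.
Proof.
elim: i => [|i ih]; first by rewrite expg0 expr0 chi1.
by rewrite expgS exprS (hd_chiM hD) ih.
Qed.

Lemma commute_z g i : commute (z ^+ i)%g g.
Proof. by apply/commute_sym/commuteX/commute_sym/(hd_central hD). Qed.

Lemma commute_zV g i : commute (z ^- i)%g g.
Proof. exact/commute_sym/commuteV/commute_sym/commute_z. Qed.

Definition mon g i : H := gr g * x ^+ i.

Lemma mon0 g : mon g 0 = gr g. Proof. by rewrite /mon expr0 mulr1. Qed.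
Lemma mon1 i : mon 1%g i = x ^+ i.
Proof. by rewrite /mon (HD_one hH) mul1r. Qed.
Lemma mon10 : mon 1%g 0 = 1. Proof. by rewrite mon1. Qed.
Lemma mon11 : mon 1%g 1 = x. Proof. by rewrite mon1 expr1. Qed.

Lemma x_gr g i : x ^+ i * gr g = chi g ^+ i *: (gr g * x ^+ i).
Proof.
elim: i => [|i ih]; first by rewrite !expr0 mul1r mulr1 scale1r.
rewrite exprSr -mulrA (HD_xg hH) -pzscalerAr mulrA ih -pzscalerAl scalerA.
by rewrite -mulrA -exprSr -exprS.
Qed.

Lemma monM g h i j : mon g i * mon h j = chi h ^+ i *: mon (g * h)%g (i + j).
Proof.
rewrite /mon -mulrA [x ^+ i * _]mulrA x_gr -pzscalerAl -pzscalerAr.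
by rewrite -mulrA -exprD mulrA (HD_mul hH).
Qed.

Lemma mon_addn g i :
  mon g (n + i) = lam *: (mon (g * z ^+ n)%g i - mon g i).
Proof.
rewrite /mon exprD (HD_xn hH) -pzscalerAl -pzscalerAr; congr (_ *: _).
by rewrite mulrBl mul1r mulrBr mulrA (HD_mul hH).
Qed.

Lemma mon_eq0 g i : ~~ twisted z lam n -> (n <= i)%N -> mon g i = 0.
Proof.
rewrite /twisted negb_and !negbK => tw /subnKC <-; rewrite mon_addn.
by case/orP: tw => /eqP ->; rewrite ?scale0r // mulg1 subrr scaler0.
Qed.

Definition mon_set (h : H) := exists g i, (i < n)%N /\ h = mon g i.

Definition basis_coef (h : H) : {ffun G * 'I_n -> k} := sval (cid (HD_basis hH h)).

Lemma basis_coefE h : h = \sum_u basis_coef h u *: mon u.1 u.2.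
Proof. by rewrite /basis_coef; case: cid => f []. Qed.

Lemma basis_coef_uniq h (f : {ffun G * 'I_n -> k}) :
  h = \sum_u f u *: mon u.1 u.2 -> basis_coef h = f.
Proof. by rewrite /basis_coef; case: cid => f' /= [_ hf'] /hf'. Qed.

Lemma basis_coef_mon g (i : 'I_n) :
  basis_coef (mon g i) = [ffun u => (u == (g, i))%:R].
Proof.
apply: basis_coef_uniq; rewrite (bigD1 (g, i)) //= ffunE eqxx scale1r.
by rewrite big1 ?addr0 // => u /negPf ug; rewrite ffunE ug scale0r.
Qed.

Lemma coord_linear g (i : nat) : linear (fun h : H =>
  if insub i is Some i' then basis_coef h (g, i') : k^o else 0).
Proof.
move=> a u v; case: insub => [i'|]; last by rewrite scaler0 addr0.
suff -> : basis_coef (a *: u + v) = [ffun w => a * basis_coef u w + basis_coef v w].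
  by rewrite ffunE.
apply: basis_coef_uniq; rewrite {1}(basis_coefE u) {1}(basis_coefE v).
rewrite scaler_sumr -big_split; apply: eq_bigr => w _ /=.
by rewrite ffunE scalerA -scalerDl.
Qed.

(* The coefficient of [mon g i], extended by 0 to all exponents [i >= n]. *)
Definition coord g i : {linear H -> k^o} := sval (linear_map (coord_linear g i)).

Lemma coordE g i h :
  coord g i h = if insub i is Some i' then basis_coef h (g, i') else 0.
Proof. by rewrite /coord; case: linear_map => f /= ->. Qed.

Lemma coord_ge g i h : (n <= i)%N -> coord g i h = 0.
Proof. by rewrite coordE leqNgt => ni; rewrite insubN. Qed.

Lemma coord_mon g i h j : (j < n)%N ->
  coord g i (mon h j) = ((g == h) && (i == j))%:R.
Proof.
move=> jn; case: (ltnP i n) => ni; last first.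
  by rewrite coord_ge // (gtn_eqF (leq_trans jn ni)) andbF.
rewrite coordE insubT /= -[j]/(val (Ordinal jn)) basis_coef_mon ffunE.
by rewrite xpair_eqE -val_eqE.
Qed.

Lemma mon_expand (h : H) : h = \sum_g \sum_(i < n) (coord g i h : k) *: mon g i.
Proof.
rewrite [LHS]basis_coefE pair_bigA; apply: eq_bigr => -[g i] _ /=.
by rewrite coordE valK.
Qed.

Lemma spanning_mon : spanning mon_set.
Proof.
move=> h; rewrite (mon_expand h).
apply: lspan_sum => g _; apply: lspan_sum => i _.
by apply: lspanZ; apply: lspan_gen; exists g, i.
Qed.

Lemma braid_mon g h i j : (i < n)%N -> (j < n)%N ->
  braid H (mon g i \ot mon h j) = q ^+ (i * j) *: (mon h j \ot mon g i).
Proof. exact: (HD_braid hH). Qed.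

Lemma counit_mon g i : counit H (mon g i) = (i == 0%N)%:R.
Proof.
rewrite /mon (bb_counitM (bb_axioms H)) (HD_counit_g hH) mul1r.
elim: i => [|i ih]; first by rewrite expr0 (bb_counit1 (bb_axioms H)).
by rewrite exprS (bb_counitM (bb_axioms H)) (HD_counit_x hH) mul0r.
Qed.

(** Induction on [i], multiplying by Delta(x). The braid contributes q^(i - j), and moving z to the
    left of x^(i - j) contributes chi(z)^(i - j); together they give the power of q chi(z) in the
    Pascal rule. *)
Lemma comul_mon g i : (i < n)%N ->
  comul H (mon g i) = \sum_(j < i.+1)
    qbin qp j (i - j) *: (mon g j \ot mon (g * z ^+ j)%g (i - j)).
Proof.
elim: i => [|i ih] ni.
  rewrite big_ord1 /= subnn expg0 mulg1 mon0 (HD_comul_g hH).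
  by rewrite (qbin0l n_gt1 qp_prim) // scale1r.
have -> : mon g i.+1 = tmul H (mon g i \ot x) by rewrite tmulE /mon exprSr mulrA.
rewrite -[LHS]/((comul H \o tmul H) _) (bb_comulM (bb_axioms H)) /= tmapE.
rewrite (ih (ltnW ni)) (HD_comul_x hH).
pose F : {linear (H \ox H) \ox (H \ox H) -> H \ox H} :=
  (tmul H \om tmul H) \o tmid H H (braid H).
have FE a b c d c' b' : braid H (b \ot c) = c' \ot b' ->
    F ((a \ot b) \ot (c \ot d)) = (a * c') \ot (b' * d).
  by move=> hb; rewrite -[LHS]/(tmap _ _ (tmid _ _ _ _)) (tmidE _ _ hb) tmapE !tmulE.
rewrite -[LHS]/(F _); clearbody F.
rewrite linear_sumlz (linear_sum F).
transitivity (\sum_(j < i.+1) (qbin qp j (i - j) *: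
     (mon g j \ot mon (g * z ^+ j)%g (i - j).+1) +
   (qbin qp j (i - j) * qp ^+ (i - j)) *:
     (mon g j.+1 \ot mon (g * z ^+ j.+1)%g (i - j)))).
  apply: eq_bigr => j _.
  rewrite linearZl_LR linearZ -scalerA -scalerDr; congr (_ *: _).
  have ijn : (i - j < n)%N by apply: leq_ltn_trans (leq_subr _ _) (ltnW ni).
  rewrite linearDr linearD; congr (_ + _).
    rewrite (FE _ _ _ _ 1 (mon (g * z ^+ j)%g (i - j))); last first.
      exact: (bb_braid1r (bb_axioms H)).
    by rewrite mulr1 -{1}mon11 monM chi1 expr1n scale1r mulg1 addn1.
  rewrite (FE _ _ _ _ x (q ^+ (i - j) *: mon (g * z ^+ j)%g (i - j))); last first.
    by rewrite -mon11 braid_mon // muln1 linearZr_LR.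
  rewrite -mon11 monM chi1 expr1n scale1r mulg1 addn1.
  rewrite -pzscalerAl -mon0 monM scalerA addn0 -mulgA -expgSr linearZr_LR.
  by rewrite exprMn.
rewrite big_split /=.
(* The two extreme terms are matched separately; the inner ones pair up by [qbinS]. *)
rewrite big_ord_recl [X in _ + X]big_ord_recr /=.
rewrite [RHS]big_ord_recl [X in _ = _ + X]big_ord_recr /=.
have qb0 := qbin0l n_gt1 qp_prim; have qbr := qbin0r n_gt1 qp_prim.
rewrite !subn0 !subnn expr0 mulr1 -!addrA /bump !leq0n !add1n /=.
rewrite !qb0 ?(ltnW ni) // !qbr ?(ltnW ni) //; congr (_ + _).
rewrite addrA -big_split /=; congr (_ + _); apply: eq_bigr => j _.
rewrite !add1n subSS; have ji : (j < i)%N by [].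
rewrite -(subnSK ji) -scalerDl (qbinS n_gt1 qp_prim) //.
- by rewrite [_ * qp ^+ _]mulrC.
- exact: leq_ltn_trans ji (ltnW ni).
- by rewrite (subnSK ji); apply: leq_ltn_trans (leq_subr _ _) (ltnW ni).
Qed.


(** * Coefficients of tensors over the basis of H *)

Section TensorCoordinates.
Variable V : lmodType k.

Definition tcoord g i : {linear V \ox H -> V} :=
  sval (linear_map (linearP (tunitr V \o (idl V \om coord g i)))).

Lemma tcoordE g i v h : tcoord g i (v \ot h) = (coord g i h : k) *: v.
Proof.
rewrite /tcoord; case: linear_map => f /= ->.
by rewrite -[LHS]/(tunitr _ (tmap _ _ _)) tmapE tunitrE.
Qed.

Lemma tcoord_mon g i v h j : (j < n)%N ->
  tcoord g i (v \ot mon h j) = if (g == h) && (i == j) then v else 0.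
Proof.
by move=> jn; rewrite tcoordE coord_mon //; case: ifP; rewrite (scale1r, scale0r).
Qed.

Lemma spanning_tmon : spanning (ptens_set (fun _ : V => True) mon_set).
Proof. exact: spanning_tens (@spanning_full _ V) spanning_mon. Qed.

Lemma tcoord_ge g i t : (n <= i)%N -> tcoord g i t = 0.
Proof.
move=> ni; elim: (spanning_tmon t) => [|a u v [w [h [_ _ ->]]] _ ih].
  by rewrite linear0.
by rewrite linearP ih tcoordE coord_ge // scale0r scaler0 addr0.
Qed.

Lemma tcoord_expand t : t = \sum_g \sum_(i < n) tcoord g i t \ot mon g i.
Proof.
elim/lspan_ind2: (spanning_tmon t) => {t} [|t u it iu|a t it|_ [v [h [_ _ ->]]]].
- by rewrite big1 // => g _; rewrite big1 // => i _; rewrite linear0 linear0l.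
- rewrite {1}it {1}iu -big_split; apply: eq_bigr => g _ /=.
  rewrite -big_split; apply: eq_bigr => i _ /=.
  by rewrite (linearD (tcoord g i)) linearDl.
- rewrite {1}it scaler_sumr; apply: eq_bigr => g _.
  rewrite scaler_sumr; apply: eq_bigr => i _.
  by rewrite (linearZ_LR (tcoord g i)) linearZl_LR.
- rewrite {1}(mon_expand h) linear_sumr; apply: eq_bigr => g _.
  rewrite linear_sumr; apply: eq_bigr => i _.
  by rewrite tcoordE linearZr_LR linearZl_LR.
Qed.

Lemma tcoord_inj t u : (forall g i, tcoord g i t = tcoord g i u) -> t = u.
Proof.
move=> tu; rewrite (tcoord_expand t) (tcoord_expand u).
by apply: eq_bigr => g _; apply: eq_bigr => i _; rewrite tu.
Qed.

Definition lcoord g i : {linear H \ox V -> V} :=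
  sval (linear_map (linearP (tunitl V \o (coord g i \om idl V)))).

Lemma lcoordE g i h v : lcoord g i (h \ot v) = (coord g i h : k) *: v.
Proof.
rewrite /lcoord; case: linear_map => f /= ->.
by rewrite -[LHS]/(tunitl _ (tmap _ _ _)) tmapE tunitlE.
Qed.

Definition tcoord2 g i h j : {linear V \ox (H \ox H) -> V} :=
  sval (linear_map (linearP
    (tcoord h j \o (tcoord g i \om idl H) \o tassocV V H H))).

Lemma tcoord2E g i h j v a b :
  tcoord2 g i h j (v \ot (a \ot b)) = (coord h j b : k) *: ((coord g i a : k) *: v).
Proof.
rewrite /tcoord2; case: linear_map => f /= ->.
rewrite -[LHS]/(tcoord h j (tmap _ _ (tassocV _ _ _ _))) tassocVE tmapE tcoordE.
by congr (_ *: _); apply: tcoordE.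
Qed.

Lemma tcoord2_assoc g i h j (w : V \ox H) m :
  tcoord2 g i h j (tassoc V H H (w \ot m)) = (coord h j m : k) *: tcoord g i w.
Proof.
elim/lspan_ind2: (spanning_tmon w) => {w} [|t u it iu|a t it|_ [v [l [_ _ ->]]]].
- by rewrite linear0l !linear0.
- by rewrite linearDl !linearD it iu.
- rewrite linearZl_LR (linearZ_LR (tassoc V H H)) (linearZ_LR (tcoord2 _ _ _ _)) /=.
  by rewrite it (linearZ_LR (tcoord g i)) !scalerA mulrC.
- by rewrite tassocE tcoord2E tcoordE.
Qed.

Lemma tcoord2_map (f : {linear V -> V \ox H}) g i h j (r : V \ox H) :
  tcoord2 g i h j (tassoc V H H ((f \om idl H) r)) = tcoord g i (f (tcoord h j r)).
Proof.
elim/lspan_ind2: (spanning_tmon r) => {r} [|t u it iu|a t it|_ [v [l [_ _ ->]]]].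
- by rewrite !linear0.
- by rewrite (linearD (tmap _ _)) !linearD it iu.
- rewrite (linearZ_LR (tmap _ _)) (linearZ_LR (tassoc V H H)) (linearZ_LR (tcoord2 _ _ _ _)) /=.
  by rewrite it (linearZ_LR (tcoord h j)) (linearZ_LR f) (linearZ_LR (tcoord g i)).
- by rewrite tmapE tcoord2_assoc tcoordE linearZ (linearZ_LR (tcoord g i)).
Qed.

(** Applying [s] twice corresponds to composing coefficient maps, which turns the axioms on [s] into
    identities between endomorphisms. *)
Lemma tcoord2_pass (s : {linear H \ox V -> V \ox H}) g i h j l m v :
  tcoord2 g i h j (pass_left s s ((l \ot m) \ot v)) =
  tcoord g i (s (l \ot tcoord h j (s (m \ot v)))).
Proof.
rewrite pass_left_tens; move: (s (m \ot v)) => r.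
elim/lspan_ind2: (spanning_tmon r) => {r} [|t u it iu|a t it|_ [w [b [_ _ ->]]]].
- by rewrite !(linear0, linear0r).
- by rewrite (linearD (tcoord h j)) !linearDr (linearD (tassocV H V H)) !linearD it iu.
- rewrite (linearZ_LR (tcoord h j)) linearZr_LR (linearZ_LR (tassocV H V H)).
  rewrite (linearZ_LR (tmap _ _)).
  rewrite (linearZ_LR (tassoc V H H)) (linearZ_LR (tcoord2 _ _ _ _)) /= it.
  by rewrite linearZr_LR (linearZ_LR s) (linearZ_LR (tcoord _ _)).
- rewrite tassocVE tmapE tcoord2_assoc tcoordE linearZr_LR (linearZ_LR s).
  by rewrite (linearZ_LR (tcoord _ _)).
Qed.

(** The coproduct of [mon a m] only contains the pairs [mon a l], [mon (a * z ^+ l) (m - l)], which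
    forces h = g z^i. *)
Lemma tcoord2_comul g i h j (r : V \ox H) : tcoord2 g i h j ((idl V \om comul H) r) =
  if h == (g * z ^+ i)%g then qbin qp i j *: tcoord g (i + j) r else 0.
Proof.
elim/lspan_ind2: (spanning_tmon r) => {r} [|t u it iu|a t it|_ [v [_ [_ [a [m [mn ->]]] ->]]]].
- by rewrite !linear0; case: ifP; rewrite ?scaler0.
- rewrite (linearD (tmap _ _)) !linearD it iu.
  by case: ifP; rewrite ?addr0 // scalerDr.
- rewrite (linearZ_LR (tmap _ _)) (linearZ_LR (tcoord2 _ _ _ _)) (linearZ_LR (tcoord _ _)) /= it.
  by case: ifP; rewrite ?scaler0 // !scalerA mulrC.
- rewrite tmapE tcoord_mon // comul_mon // linear_sumr (linear_sum (tcoord2 _ _ _ _)).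
  have E (l : 'I_m.+1) : tcoord2 g i h j (idl V v \ot (qbin qp l (m - l) *:
      (mon a l \ot mon (a * z ^+ l)%g (m - l)))) =
      if [&& g == a, i == l, h == (a * z ^+ l)%g & j == (m - l)%N]
      then qbin qp l (m - l) *: v else 0.
    have ln : (l < n)%N := leq_trans (ltn_ord l) mn.
    have mln : (m - l < n)%N by apply: leq_ltn_trans (leq_subr _ _) mn.
    rewrite linearZr_LR (linearZ_LR (tcoord2 _ _ _ _)) /= tcoord2E !coord_mon //.
    by do 4 case: eqP => _; rewrite /= ?(scale0r, scaler0) // !scale1r.
  rewrite (eq_bigr _ (fun l _ => E l)); case: (h =P _) => [->|hg]; last first.
    rewrite big1 // => l _; case: ifP => // /and4P[/eqP ga /eqP il /eqP hl _].
    by case: hg; rewrite hl il ga.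
  have [ijm|ijm] := eqVneq (i + j)%N m; last first.
    rewrite andbF scaler0 big1 // => l _.
    case: ifP => // /and4P[_ /eqP il _ /eqP jl]; case/eqP: ijm.
    by rewrite il jl subnKC // -ltnS.
  have im : (i < m.+1)%N by rewrite ltnS -ijm leq_addr.
  rewrite andbT (bigD1 (Ordinal im)) //= big1 => [|l /negPf li]; last first.
    by rewrite eq_sym in li; rewrite -[i]/(val (Ordinal im)) val_eqE li andbF.
  rewrite addr0 eqxx -ijm addKn eqxx andbT /=.
  by case: eqP => [->|] /=; rewrite ?eqxx ?scaler0.
Qed.

Lemma tcoord2_braid g i h j (r : V \ox (H \ox H)) :
  tcoord2 g i h j ((idl V \om braid H) r) = q ^+ (i * j) *: tcoord2 h j g i r.
Proof.
pose F : {linear V \ox (H \ox H) -> V} := tcoord2 g i h j \o (idl V \om braid H).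
pose F' : {linear V \ox (H \ox H) -> V} := q ^+ (i * j) \*: tcoord2 h j g i.
rewrite -[LHS]/(F r) -[RHS]/(F' r).
apply: (lin_ext (spanning_tens (@spanning_full _ V) (spanning_tens spanning_mon spanning_mon))).
move=> _ [v [_ [_ [_ [_ [[a [l [ln ->]]] [b [m [mn ->]]] ->]]] ->]]].
transitivity (q ^+ (l * m) *:
    ((coord h j (mon a l) : k) *: ((coord g i (mon b m) : k) *: v))).
  rewrite -[LHS]/(tcoord2 g i h j (tmap _ _ _)) tmapE (braid_mon _ _ ln mn).
  by rewrite linearZr_LR (linearZ_LR (tcoord2 g i h j)) tcoord2E.
rewrite -[RHS]/(_ *: tcoord2 h j g i _) tcoord2E !coord_mon //.
case: (i =P m) => [->|_]; last by rewrite !andbF !scale0r !scaler0.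
case: (j =P l) => [->|_]; last by rewrite !andbF !(scale0r, scaler0).
by rewrite [(m * l)%N]mulnC; congr (_ *: _); rewrite !scalerA mulrC.
Qed.

Lemma tcoord_counit (r : V \ox H) :
  tunitr V ((idl V \om counit H) r) = \sum_g tcoord g 0 r.
Proof.
elim/lspan_ind2: (spanning_tmon r) => {r} [|t u it iu|a t it|_ [v [_ [_ [a [m [mn ->]]] ->]]]].
- by rewrite !linear0 big1 // => g _; rewrite linear0.
- rewrite (linearD (tmap _ _)) linearD it iu -big_split.
  by apply: eq_bigr => g _; rewrite linearD.
- rewrite (linearZ_LR (tmap _ _)) (linearZ_LR (tunitr V)) /= it scaler_sumr.
  by apply: eq_bigr => g _; rewrite (linearZ_LR (tcoord _ _)).
- rewrite tmapE tunitrE counit_mon (bigD1 a) //= tcoord_mon // eqxx big1 ?addr0 => [|g /negPf ga].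
    by rewrite eq_sym; case: eqP; rewrite ?scale1r ?scale0r.
  by rewrite tcoord_mon // ga.
Qed.

End TensorCoordinates.

Arguments tcoord {V} g i.
Arguments tcoord2 {V} g i h j.
Arguments lcoord {V} g i.

(** * The product of two coactions *)

Lemma aut_z (zeta : [subg aut_chiz chi z]) : sgval zeta z = z.
Proof. by have := subgP zeta; rewrite inE => /andP[_ /andP[/eqP]]. Qed.

Lemma aut_chi (zeta : [subg aut_chiz chi z]) g : chi (sgval zeta g) = chi g.
Proof.
by have := subgP zeta; rewrite inE => /andP[_ /andP[_ /forallP/(_ g)/eqP]].
Qed.

Lemma aut1 (zeta : [subg aut_chiz chi z]) : sgval zeta 1%g = 1%g.
Proof. by apply: (mulIg (sgval zeta 1%g)); rewrite -aut_chizM !mul1g. Qed.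

Lemma autX (zeta : [subg aut_chiz chi z]) g i :
  sgval zeta (g ^+ i)%g = (sgval zeta g ^+ i)%g.
Proof.
by elim: i => [|i ih]; rewrite ?expg0 ?aut1 // !expgS aut_chizM ih.
Qed.

Lemma autV (zeta : [subg aut_chiz chi z]) g :
  sgval zeta g^-1%g = (sgval zeta g)^-1%g.
Proof. by apply: (mulIg (sgval zeta g)); rewrite -aut_chizM !mulVg aut1. Qed.

Lemma aut_zV (zeta : [subg aut_chiz chi z]) g i :
  sgval zeta (z ^- i * g)%g = (z ^- i * sgval zeta g)%g.
Proof. by rewrite aut_chizM autV autX aut_z. Qed.

Lemma zVD i j : (z ^- (i + j) = z ^- i * z ^- j)%g.
Proof. by rewrite addnC expgD invMg. Qed.

(* The tail of the sum, folded back by x^n = lam (z^n - 1). *)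
Lemma sum_mon_addn (B : lmodType k) (F : nat -> B) g :
  \sum_(m < n + n) F m \ot mon (z ^- m * g)%g m =
  \sum_(m < n) (F m + lam *: F (n + m)%N) \ot mon (z ^- m * g)%g m
  - \sum_(m < n) (lam *: F (n + m)%N) \ot mon (z ^- m * (z ^- n * g))%g m.
Proof.
rewrite big_split_ord /= -sumrB -big_split; apply: eq_bigr => m _ /=.
rewrite linearDl -addrA; congr (_ + _).
rewrite mon_addn linearZr_LR -linearZl_LR linearBr.
congr (_ \ot mon _ _ - _ \ot mon _ _); last by rewrite addnC zVD mulgA.
by rewrite addnC zVD -!mulgA [(g * _)%g](commute_sym (commute_z g n)) mulKg.
Qed.

(* [qfact qp i = 0] for [i >= n], so that [wt i = 0] there. *)
Definition wt i : k := (qfact qp i)^-1.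

Lemma wt_eq0 i : (n <= i)%N -> wt i = 0.
Proof. by move=> ni; rewrite /wt (qfact_eq0 n_gt1 qp_prim ni) invr0. Qed.

Lemma wt0 : wt 0 = 1. Proof. by rewrite /wt qfact0 invr1. Qed.

Lemma wtK i : (i < n)%N -> qfact qp i * wt i = 1.
Proof. by move=> ni; rewrite divff ?(qfact_neq0 n_gt1 qp_prim). Qed.

Lemma wtK' i : (i < n)%N -> wt i * qfact qp i = 1.
Proof. by rewrite mulrC; apply: wtK. Qed.

Lemma wtS i : (i.+1 < n)%N -> wt i = wt i.+1 * qint qp i.+1.
Proof.
move=> ni; rewrite /wt qfactS invfM mulfVK // (qint_eq0 n_gt1 qp_prim).
by rewrite gtnNdvd.
Qed.

Section Homogeneous.
Variables (B : pzAlgebra k) (D : gop chi z -> set B) (alpha U : {linear B -> B}).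

(** The contribution of the [i]-th term of nu(b) and the [j]-th term of nu(c), when [h] is the group
    degree of [c]; the power of chi comes from moving x^i past z^-j h. *)
Definition hterm h (b c : B) i j : B :=
  (wt i * wt j * chi (z ^- j * h)%g ^+ i) *: (iter i U b * iter i alpha (iter j U c)).

(** The element S_m of the overview. For m >= n the range also contains indices beyond n - 1, but
    these carry weight 0. *)
Definition hsum h b c m : B := \sum_(i < m.+1) hterm h b c i (m - i).

(* The exponents agree because [chi z ^+ n = 1], so that p^(j^2) = p^(-(n-j)j). *)
Lemma twisted_termE h b c : twisted z lam n ->
  twisted_term chi z lam q n alpha U h b c = - lam *: hsum h b c n.
Proof.
move=> tw; have zn : chi z ^+ n = 1 by apply: (hd_twisted hD).
rewrite /twisted_term /hsum; congr (_ *: _).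
rewrite -(big_mkord predT (fun i => hterm h b c i (n - i))).
(* The terms i = 0 and i = n, absent from [twisted_term], carry the factor [wt n = 0]. *)
have T0 : hterm h b c 0 (n - 0) = 0.
  by rewrite /hterm subn0 (wt_eq0 (leqnn n)) mulr0 mul0r scale0r.
have Tn : hterm h b c n (n - n) = 0.
  by rewrite /hterm (wt_eq0 (leqnn n)) !mul0r scale0r.
rewrite big_nat_recr //= [X in _ = X + _]big_ltn // T0 Tn add0r addr0.
apply: eq_big_nat => j /andP[_ jn].
rewrite /hterm; congr (_ *: _); rewrite invfM mulrC; congr (_ * _).
rewrite (hd_chiM hD) chiV chiX exprMn; congr (_ * _); rewrite exprVn -exprM.
have pz := hd_chi_neq0 hD z.
apply: (mulIf (expf_neq0 ((n - j) * j) pz)); rewrite mulVf ?expf_neq0 //.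
by rewrite -exprD -mulnn -mulnDl subnKC ?(ltnW jn) // exprM zn expr1n.
Qed.

Hypothesis gD : gradation D.
Hypothesis alpha_mul : monoid_morphism alpha.
Hypothesis alpha_in : forall d b, D d b -> D d (alpha b).
Hypothesis U_in : forall d b, D d b -> D ((z^-1 * d.1)%g, d.2) (U b).
Hypothesis U_alpha : forall b, U (alpha b) = q *: alpha (U b).

Lemma iter_alpha_in d b i : D d b -> D d (iter i alpha b).
Proof. by move=> Db; elim: i => //= i; apply: alpha_in. Qed.

Lemma iter_U_in d b i : D d b -> D ((z ^- i * d.1)%g, d.2) (iter i U b).
Proof.
case: d => g zeta Db; elim: i => [|i ih] /=; first by rewrite invg1 mul1g.
by have := U_in ih; rewrite /= mulgA expgSr invMg.
Qed.

Lemma iter_alphaM i b c : iter i alpha (b * c) = iter i alpha b * iter i alpha c.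
Proof. by elim: i => //= i ->; rewrite alpha_mul.2. Qed.

Lemma iter_alpha1 i : iter i alpha 1 = 1.
Proof. by elim: i => //= i ->; rewrite alpha_mul.1. Qed.

Lemma U_iter_alpha i b : U (iter i alpha b) = q ^+ i *: iter i alpha (U b).
Proof.
elim: i => [|i ih] /=; first by rewrite expr0 scale1r.
by rewrite U_alpha ih linearZ /= scalerA exprS.
Qed.

Lemma iter_U_iter_alpha i j b :
  iter i U (iter j alpha b) = q ^+ (i * j) *: iter j alpha (iter i U b).
Proof.
elim: i => [|i ih] /=; first by rewrite mul0n expr0 scale1r.
by rewrite ih linearZ /= U_iter_alpha scalerA -exprD mulSn addnC.
Qed.

Section Derivation.
Hypothesis U_nilp : forall b, iter n U b = 0.
Hypothesis U_mul : forall b h c, part_grp D h c ->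
  U (b * c) = b * U c + chi h *: (U b * alpha c).

Lemma iter_U_eq0 i b : (n <= i)%N -> iter i U b = 0.
Proof. by move/subnK <-; rewrite iterD U_nilp; elim: (i - n)%N => //= j ->; rewrite linear0. Qed.

Lemma part_grp_in d b : D d b -> part_grp D d.1 b.
Proof. by move=> Db; apply: (part_in gD _ Db); apply: eqxx. Qed.

(** The derivation rule sends the (i, j) term to the (i, j + 1) and (i + 1, j) terms. Those arriving
    at a fixed (i, j) with i + j = m + 1 have total factor (i) + (qp)^i (j) = (m + 1), as quantum
    integers at qp. *)
Lemma U_hsum e b c m : D e c ->
  U (hsum e.1 b c m) = qint qp m.+1 *: hsum e.1 b c m.+1.
Proof.
move=> Dc; set h := e.1.
pose X i j : B := iter i U b * iter i alpha (iter j U c).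
pose w i j : k := wt i * wt j * chi (z ^- j * h)%g ^+ i.
(* At the boundary [wtS] no longer applies, but there U^n = 0 makes both sides vanish. *)
have X0 i j : (n <= i)%N || (n <= j)%N -> X i j = 0.
  case/orP=> [/iter_U_eq0|/iter_U_eq0] E; rewrite /X E ?mul0r //.
  by rewrite iter_linear0 mulr0.
pose y i j : B := (w i j * (qint qp j * qp ^+ i)) *: X i j.
pose y' i j : B := (w i j * qint qp i) *: X i j.
have UT i j : U (hterm h b c i j) = y i j.+1 + y' i.+1 j.
  rewrite /hterm linearZ /= (U_mul _ (h := (z ^- j * h)%g)); last first.
    exact: (part_grp_in (iter_alpha_in i (iter_U_in j Dc))).
  rewrite U_iter_alpha -pzscalerAr -/(X i j.+1) -/(X i.+1 j) scalerDr !scalerA.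
  congr (_ + _).
    have [jn|nj] := ltnP j.+1 n; last by rewrite /y !X0 ?nj ?orbT // !scaler0.
    rewrite /y /w (wtS jn); congr (_ *: _).
    (* The extra factor z gives chi(z)^i, which combines with the q^i of [U_iter_alpha] into
       (qp)^i. *)
    have -> : (z ^- j * h = z * (z ^- j.+1 * h))%g.
      by rewrite expgSr invMg !mulgA mulgV mul1g.
    by rewrite (hd_chiM hD z) !exprMn; ring.
  have [jn|nj] := ltnP i.+1 n; last by rewrite /y' !X0 ?nj // !scaler0.
  by rewrite /y' /w (wtS jn); congr (_ *: _); rewrite exprS; ring.
rewrite /hsum linear_sum (eq_bigr _ (fun i _ => UT _ _)) big_split /=.
transitivity (\sum_(i < m.+2) (y i (m.+1 - i)%N + y' i (m.+1 - i)%N)); last first.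
  rewrite scaler_sumr; apply: eq_bigr => i _.
  rewrite /y /y' /hterm -/(X _ _) -/(w _ _) -scalerDl scalerA -mulrDr; congr (_ *: _).
  have im : (i <= m.+1)%N by rewrite -ltnS.
  have -> : qint qp m.+1 = qint qp i + qp ^+ i * qint qp (m.+1 - i).
    by rewrite -qintD subnKC.
  by rewrite mulrC [qp ^+ _ * _]mulrC addrC.
rewrite big_split /=; congr (_ + _).
  rewrite [RHS]big_ord_recr /= subnn /y /qint big_ord0 mul0r mulr0 scale0r addr0.
  by apply: eq_bigr => i _; rewrite subSn // -ltnS.
rewrite [RHS]big_ord_recl /= /y' {2}/qint big_ord0 mulr0 scale0r add0r.
by apply: eq_bigr => i _; rewrite /bump leq0n add1n subSS.
Qed.

Lemma hsum0 h b c : hsum h b c 0 = b * c.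
Proof. by rewrite /hsum big_ord1 /hterm /= wt0 !mul1r expr0 scale1r. Qed.

(** As n divides l, the quantum integer (l) is 0 and (qp)^l = 1, so each factor (l + m + 1) produced
    by [U_hsum] equals (m + 1). *)
Lemma iter_U_hsum e b c l m : D e c -> (n %| l)%N ->
  iter m U (hsum e.1 b c l) = qfact qp m *: hsum e.1 b c (l + m).
Proof.
move=> Dc nl; elim: m => [|m ih] /=; first by rewrite addn0 qfact0 scale1r.
rewrite ih linearZ /= U_hsum // scalerA -addnS qfactS qintD.
move: nl; rewrite (prim_order_dvd qp_prim) -(prim_order_dvd qp_prim) => nl.
have /eqP -> : qint qp l == 0 by rewrite (qint_eq0 n_gt1 qp_prim).
by move: nl; rewrite (prim_order_dvd qp_prim) => /eqP ->; rewrite add0r mul1r.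
Qed.

End Derivation.


Section ProductFormula.
Variables (s : {linear H \ox B -> B \ox H}) (nu : {linear B -> B \ox H}).
Hypothesis s_hom : forall d b g i, (i < n)%N -> D d b ->
  s (mon g i \ot b) = iter i alpha b \ot mon (sgval d.2 g) i.
Hypothesis nu_hom : forall d b, D d b ->
  nu b = \sum_(i < n) wt i *: (iter i U b \ot mon (z ^- i * d.1)%g i).

(** Only the formulas on homogeneous elements are assumed for [s] and [nu], so the expansion serves
    both to construct a coaction and to analyse a given one. The automorphism attached to [c] fixes
    z, hence preserves the powers z^-i. *)
Lemma product_formula d e b c : D d b -> D e c ->
  (tmul B \om tmul H) (tmid B H s (nu b \ot nu c)) =
  \sum_(m < n + n) hsum e.1 b c m \ot mon (z ^- m * (d * e)%g.1)%g m.
Proof.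
move=> Db Dc.
pose F : {linear (B \ox H) \ox (B \ox H) -> B \ox H} :=
  (tmul B \om tmul H) \o tmid B H s.
have FE b1 h c1 l c' h' : s (h \ot c1) = c' \ot h' ->
    F ((b1 \ot h) \ot (c1 \ot l)) = (b1 * c') \ot (h' * l).
  by move=> hb; rewrite -[LHS]/(tmap _ _ (tmid _ _ _ _)) (tmidE _ _ hb) tmapE !tmulE.
rewrite -[LHS]/(F _); clearbody F.
rewrite (nu_hom Db) (nu_hom Dc) linear_sumlz (linear_sum F).
pose T i j := hterm e.1 b c i j \ot mon (z ^- (i + j) * (d * e)%g.1)%g (i + j).
transitivity (\sum_(i < n) \sum_(j < n) T i j).
  apply: eq_bigr => i _; rewrite linear_sumr (linear_sum F); apply: eq_bigr => j _.
  rewrite linearZl_LR linearZr_LR !(linearZ_LR F).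
  rewrite (FE _ _ _ _ _ _ (s_hom _ (ltn_ord i) (iter_U_in j Dc))) /= aut_zV monM.
  rewrite linearZr_LR !scalerA -linearZl_LR; congr (_ \ot mon _ _).
  by rewrite zVD -!mulgA; congr (_ * _)%g; rewrite !mulgA (commute_zV _ j).
rewrite triangular_sum => [|i j ni|i j nj]; last 2 first.
- by rewrite /T /hterm (wt_eq0 ni) !mul0r scale0r linear0l.
- by rewrite /T /hterm (wt_eq0 nj) mulr0 mul0r scale0r linear0l.
apply: eq_bigr => m _; rewrite /hsum linear_sumlz; apply: eq_bigr => i _.
by rewrite /T subnKC // -ltnS.
Qed.

Lemma coaction_mul (U_nilp : forall b, iter n U b = 0)
    (U_mul : forall b h c, part_grp D h c ->
       U (b * c) = b * U c + chi h *: (U b * alpha c))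
    (DU : compatible lam q n D alpha U) d e b c : D d b -> D e c ->
  nu (b * c) = (tmul B \om tmul H) (tmid B H s (nu b \ot nu c)).
Proof.
move=> Db Dc; rewrite (product_formula Db Dc).
have U0 m : (m < n)%N -> iter m U (b * c) = qfact qp m *: hsum e.1 b c m.
  by move=> _; rewrite -(hsum0 e.1) (iter_U_hsum U_nilp U_mul).
move: DU; rewrite /compatible; case: ifP => tw; last first.
  case=> _ /(_ d e b c Db Dc) Dbc; rewrite (nu_hom Dbc) big_split_ord /=.
  rewrite [X in _ = _ + X]big1 ?addr0 => [|i _]; last first.
    by rewrite mon_eq0 ?tw ?leq_addr // linear0r.
  apply: eq_bigr => i _; rewrite U0 // -linearZl_LR scalerA mulrC wtK //.
  by rewrite scale1r.
case=> _ /(_ d e b c Db Dc) /(part_gproj gD) bc2 /(_ d e b c Db Dc).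
move=> /(component_gproj gD); rewrite twisted_termE // => w2E.
pose a := (d * e)%g; rewrite -/a in bc2 w2E *.
set w2 := gproj gD _ _ in w2E; pose w1 := gproj gD a (b * c).
(* As z^n differs from 1, the two degrees allowed for bc are distinct, and bc is the sum of [w1] and
   [w2]. *)
have sa : shift n a != a.
  have /andP[_ zn] := tw; apply: contraNneq zn => /(congr1 fst) /= E.
  by rewrite -invg_eq1; apply/eqP/(mulIg a.1); rewrite E mul1g.
have bcE : b * c = w1 + w2.
  rewrite [LHS]bc2 (bigD1 a) /= ?eqxx //; congr (_ + _).
  rewrite (big_pred1 (shift n a)) // => i /=.
  by case: (eqVneq i a) => [->|_] //=; rewrite ?andbT // eq_sym (negPf sa).
(* Compatibility gives w2 = -lambda S_n, so w1 = S_0 + lambda S_n; applying U^m to the two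
   components yields the two sums of [sum_mon_addn]. *)
have w1E : w1 = b * c + lam *: hsum e.1 b c n.
  by rewrite bcE w2E scaleNr subrK.
have Uw2 m : iter m U w2 = - lam *: (qfact qp m *: hsum e.1 b c (n + m)).
  have [f fE] := linear_map (iter_linear U m).
  by rewrite -fE w2E linearZ /= fE (iter_U_hsum U_nilp U_mul).
have Uw1 m : (m < n)%N -> iter m U w1 =
    qfact qp m *: (hsum e.1 b c m + lam *: hsum e.1 b c (n + m)).
  move=> mn; have [f fE] := linear_map (iter_linear U m).
  rewrite -fE w1E linearD linearZ /= !fE (iter_U_hsum U_nilp U_mul) // U0 //.
  by rewrite scalerDr !scalerA [lam * _]mulrC.
rewrite [in LHS]bcE linearD (nu_hom (gproj_in gD a _)) (nu_hom (gproj_in gD (shift n a) _)).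
rewrite sum_mon_addn -/w1 -/w2 -sumrN; congr (_ + _); apply: eq_bigr => m _.
  by rewrite Uw1 // -linearZl_LR scalerA mulrC wtK // scale1r.
rewrite Uw2 -linearZl_LR !scalerA mulrAC [wt _ * _]mulrC wtK // mul1r.
by rewrite scaleNr linearNl.
Qed.

End ProductFormula.

End Homogeneous.

(** * From the data to the comodule algebra *)

Lemma coord_sum (X : lmodType k) (F : G -> nat -> X) a m : (m < n)%N ->
  \sum_g \sum_(i < n) (coord g i (mon a m) : k) *: F g i = F a m.
Proof.
move=> mn; rewrite (bigD1 a) //= [X in X + _](bigD1 (Ordinal mn)) //=.
rewrite coord_mon // !eqxx scale1r big1 => [|i /negPf im]; last first.
  by rewrite coord_mon // -[m]/(val (Ordinal mn)) val_eqE im andbF scale0r.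
rewrite big1 ?addr0 // => g /negPf ga; rewrite big1 // => i _.
by rewrite coord_mon // ga scale0r.
Qed.

Lemma coord_tensor_map (B X : lmodType k) (L : G -> nat -> B -> X) :
  (forall g i, linear (L g i)) ->
  {F : {linear H \ox B -> X} | forall g i b, (i < n)%N -> F (mon g i \ot b) = L g i b}.
Proof.
move=> linL.
have [b|h|F FE] := @tensor_map k H B X
    (fun h b => \sum_g \sum_(i < n) (coord g i h : k) *: L g i b).
- do 2!apply: linear_bigsum => ?.
  by move=> a u v; rewrite linearP scalerDl scalerA.
- do 2!apply: linear_bigsum => ?.
  by move=> a u v; rewrite linL scalerDr !scalerA mulrC.
exists F => g i b ni.
by rewrite FE (coord_sum (fun g i => L g i b)).
Qed.

Lemma coord_tensor_mapr (B X : lmodType k) (L : G -> nat -> B -> X) :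
  (forall g i, linear (L g i)) ->
  {F : {linear B \ox H -> X} | forall g i b, (i < n)%N -> F (b \ot mon g i) = L g i b}.
Proof.
move=> linL.
have [h|b|F FE] := @tensor_map k B H X
    (fun b h => \sum_g \sum_(i < n) (coord g i h : k) *: L g i b).
- do 2!apply: linear_bigsum => ?.
  by move=> a u v; rewrite linL scalerDr !scalerA mulrC.
- do 2!apply: linear_bigsum => ?.
  by move=> a u v; rewrite linearP scalerDl scalerA.
exists F => g i b ni.
by rewrite FE (coord_sum (fun g i => L g i b)).
Qed.

Section DataToComodule.
Variables (B : pzAlgebra k) (D : gop chi z -> set B) (alpha U : {linear B -> B}).
Hypothesis cd : comodule_data lam q n D alpha U.

Let gD := cd_gradation cd.
Let alpha_mul := cd_alpha_mul cd.
Let U_alpha := cd_U_alpha cd.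
Let U_in := cd_U_graded cd.

Lemma alpha_in d b : D d b -> D d (alpha b).
Proof. by move=> Db; rewrite -(cd_alpha_graded cd); exists b. Qed.

Lemma alpha_inverse : exists2 beta : {linear B -> B},
  cancel alpha beta /\ cancel beta alpha & forall d b, D d b -> D d (beta b).
Proof.
have [f fK Kf] := cd_alpha_bij cd.
have [beta bE] := linear_map (can2_linear fK Kf).
exists beta; first by split=> b; rewrite bE.
by move=> d b; rewrite -{1}(cd_alpha_graded cd) => -[c Dc <-]; rewrite bE fK.
Qed.

Lemma one_in : D 1%g 1.
Proof. by move: (cd_compatible cd); rewrite /compatible; case: ifP => _ []. Qed.

(** The twisted correction moves only the group component of the degree, so the automorphism
    component remains multiplicative. *)
Lemma mul_in d e b c : D d b -> D e c -> part_aut D (d * e)%g.2 (b * c).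
Proof.
move=> Db Dc; move: (cd_compatible cd); rewrite /compatible; case: ifP => _.
  case=> _ /(_ d e b c Db Dc) h _; apply: (part_sub gD _ h) => i.
  by case/orP=> /eqP ->.
by case=> _ /(_ d e b c Db Dc) h; apply: (part_in gD _ h); apply: eqxx.
Qed.

Lemma transposition_ex : {s : {linear H \ox B -> B \ox H} |
  forall d b g i, (i < n)%N -> D d b ->
  s (mon g i \ot b) = iter i alpha b \ot mon (sgval d.2 g) i}.
Proof.
have [g i|s sE] := @coord_tensor_map B (B \ox H) (fun g i b =>
    \sum_d iter i alpha (gproj gD d b) \ot mon (sgval d.2 g) i).
  apply: linear_bigsum => d a u v.
  by rewrite linearP iter_linear linearPl.
exists s => d b g i ni Db; rewrite sE //.
rewrite (gproj_bigsum gD (F := fun d c => iter i alpha c \ot mon (sgval d.2 g) i) _ Db) // => e.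
by rewrite iter_linear0 linear0l.
Qed.

Lemma coaction_ex : {nu : {linear B -> B \ox H} |
  forall d b, D d b ->
  nu b = \sum_(i < n) wt i *: (iter i U b \ot mon (z ^- i * d.1)%g i)}.
Proof.
have [|nu nuE] := @linear_map k B (B \ox H) (fun b =>
    \sum_d \sum_(i < n) wt i *: (iter i U (gproj gD d b) \ot mon (z ^- i * d.1)%g i)).
  do 2!apply: linear_bigsum => ?.
  by move=> a u v; rewrite linearP iter_linear linearPl scalerDr !scalerA mulrC.
exists nu => d b Db; rewrite nuE.
rewrite (gproj_bigsum gD (F := fun d c =>
  \sum_(i < n) wt i *: (iter i U c \ot mon (z ^- i * d.1)%g i)) _ Db) // => e.
by rewrite big1 // => i _; rewrite iter_linear0 linear0l scaler0.
Qed.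

Section ComoduleAlgebraLaws.
Variables (s : {linear H \ox B -> B \ox H}) (nu : {linear B -> B \ox H}).
Hypothesis s_hom : forall d b g i, (i < n)%N -> D d b ->
  s (mon g i \ot b) = iter i alpha b \ot mon (sgval d.2 g) i.
Hypothesis nu_hom : forall d b, D d b ->
  nu b = \sum_(i < n) wt i *: (iter i U b \ot mon (z ^- i * d.1)%g i).

Let sH := spanning_mon.
Let sB := spanning_grad gD.

(** Extends the formula to every exponent. In the untwisted case both sides vanish from n on;
    otherwise x^n folds to lambda (z^n - 1), and the formula survives because zeta fixes z and
    alpha^n = id. *)
Lemma s_mon d b g i : D d b ->
  s (mon g i \ot b) = iter i alpha b \ot mon (sgval d.2 g) i.
Proof.
move=> Db; have [m] := ubnP i; elim: m i g => // m ih i g im.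
have [ni|ni] := ltnP i n; first exact: s_hom.
have [tw|tw] := boolP (twisted z lam n); last first.
  by rewrite !(mon_eq0 _ tw ni) linear0l linear0 linear0r.
move: ni im => /subnKC <-; move: (i - n)%N => {}i im.
rewrite !mon_addn linearZl_LR linearBl (linearZ_LR s) linearB.
have {}im : (i < m)%N by apply: leq_trans (im : n + i <= m)%N; rewrite -add1n leq_add2r.
rewrite !ih // iterD (cd_alpha_order cd tw) linearZr_LR linearBr.
by rewrite aut_chizM autX aut_z.
Qed.

Lemma s_part g i zeta b : part_aut D zeta b ->
  s (mon g i \ot b) = iter i alpha b \ot mon (sgval zeta g) i.
Proof.
move: b; apply: (part_ind gD) => [|u v su sv|d b /eqP <- Db].
- by rewrite iter_linear0 linear0r linear0 linear0l.
- have [f fE] := linear_map (iter_linear alpha i).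
  by rewrite linearDr linearD su sv -!fE linearD linearDl.
- exact: s_mon.
Qed.

Lemma transposition_formulaP : transposition_formula n gr x D alpha s.
Proof. by move=> g i zeta b _; apply: s_part. Qed.

Lemma coaction_formulaP : coaction_formula q n gr x D U nu.
Proof.
move=> g; apply: (part_ind gD) => [|u v su sv|d b /eqP <- Db].
- by rewrite linear0 big1 // => i _; rewrite iter_linear0 linear0l scaler0.
- rewrite linearD su sv -big_split; apply: eq_bigr => i _ /=.
  have [f fE] := linear_map (iter_linear U i).
  by rewrite -!fE linearD linearDl scalerDr.
- exact: nu_hom.
Qed.

(** The inverse applies zeta^-1 to the group factor and alpha^-i to the element of B. *)
Lemma s_bij : bijective s.
Proof.
have [beta [aK Ka] beta_in] := alpha_inverse.
have [g i|r rE] := @coord_tensor_mapr B (H \ox B) (fun g i b =>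
    \sum_d mon (((sgval d.2)^-1%g : {perm G}) g) i \ot iter i beta (gproj gD d b)).
  apply: linear_bigsum => d a u v.
  by rewrite linearP iter_linear linearPr.
have r_hom d b g i : (i < n)%N -> D d b ->
    r (b \ot mon g i) = mon (((sgval d.2)^-1%g : {perm G}) g) i \ot iter i beta b.
  move=> ni Db; rewrite rE //.
  rewrite (gproj_bigsum gD (F := fun d c =>
    mon (((sgval d.2)^-1%g : {perm G}) g) i \ot iter i beta c) _ Db) // => e.
  by rewrite iter_linear0 linear0r.
have iterK i (f h : B -> B) : cancel f h -> cancel (iter i f) (iter i h).
  by move=> fK; elim: i => // i ih b; rewrite iterSr iterS fK ih.
have iter_beta_in d b i : D d b -> D d (iter i beta b).
  by move=> Db; elim: i => //= i; apply: beta_in.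
exists r; [pose f : {linear H \ox B -> H \ox B} := r \o s|
  pose f : {linear B \ox H -> B \ox H} := s \o r].
- move=> t; rewrite -[LHS]/(f t) -[RHS]/(idl _ t); move: t.
  apply: (lin_ext (spanning_tens sH sB)) => _ [_ [b [[g [i [ni ->]]] [d Db] ->]]].
  rewrite -[LHS]/(r (s _)) (s_mon _ _ Db) (r_hom d) //; last exact: (iter_alpha_in alpha_in).
  by rewrite permK (iterK _ _ _ aK).
- move=> t; rewrite -[LHS]/(f t) -[RHS]/(idl _ t); move: t.
  apply: (lin_ext (spanning_tens sB sH)) => _ [b [_ [[d Db] [g [i [ni ->]]] ->]]].
  rewrite -[LHS]/(s (r _)) (r_hom d) // (s_mon _ _ (iter_beta_in _ _ _ Db)).
  by rewrite permKV (iterK _ _ _ Ka).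
Qed.

Lemma left_spaceP : left_space s.
Proof.
split.
- exact: s_bij.
- move=> b; elim/lspan_ind2: (sB b) => {b} [|u v su sv|a u su|b [d Db]].
  + by rewrite linear0l linear0r linear0.
  + by rewrite linearDr linearD su sv linearDl.
  + by rewrite linearZr_LR (linearZ_LR s) su linearZl_LR.
  + by rewrite -{1}mon10 (s_mon _ _ Db) aut1 mon10.
- apply: (lin_ext (spanning_tens (spanning_tens sH sH) sB)).
  move=> _ [_ [b [[_ [_ [[g [i [ni ->]]] [h [j [nj ->]]] ->]]] [d Db] ->]]].
  rewrite -[LHS]/(s (tmap _ _ _)) -[RHS]/(tmap _ _ (pass_left _ _ _)).
  rewrite (pass_leftE (s_mon _ _ Db) (s_mon _ _ (iter_alpha_in alpha_in _ Db))).
  (* The exponent i + j may reach n or more, hence the use of [s_mon] without a bound. *)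
  rewrite !tmapE !tmulE monM linearZl_LR (linearZ_LR s) (s_mon _ _ Db).
  by rewrite monM linearZr_LR aut_chi aut_chizM iterD.
- apply: (lin_ext (spanning_tens sH sB)) => _ [_ [b [[g [i [ni ->]]] [d Db] ->]]].
  rewrite -[LHS]/(tunitr _ (tmap _ _ (s _))) -[RHS]/(tunitl _ (tmap _ _ _)).
  rewrite (s_mon _ _ Db) !tmapE tunitrE tunitlE !counit_mon.
  by case: i {ni} => [|i]; rewrite ?scale1r ?scale0r.
- apply: (lin_ext (spanning_tens sH sB)) => _ [_ [b [[g [i [ni ->]]] [d Db] ->]]].
  rewrite -[LHS]/(tmap _ _ (s _)) -[RHS]/(pass_left _ _ (tmap _ _ _)).
  rewrite (s_mon _ _ Db) !tmapE !comul_mon // linear_sumr linear_sumlz.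
  rewrite (linear_sum (pass_left s s)); apply: eq_bigr => j _.
  rewrite linearZr_LR linearZl_LR (linearZ_LR (pass_left s s)).
  rewrite (pass_leftE (s_mon _ _ Db) (s_mon _ _ (iter_alpha_in alpha_in _ Db))).
  by rewrite aut_chizM autX aut_z -iterD subnKC // -ltnS.
- apply: (lin_ext (spanning_tens (spanning_tens sH sH) sB)).
  move=> _ [_ [b [[_ [_ [[g [i [ni ->]]] [h [j [nj ->]]] ->]]] [d Db] ->]]].
  rewrite -[LHS]/(pass_left _ _ (tmap _ _ _)) -[RHS]/(tmap _ _ (pass_left _ _ _)).
  rewrite (pass_leftE (s_mon _ _ Db) (s_mon _ _ (iter_alpha_in alpha_in _ Db))).
  rewrite !tmapE !braid_mon // linearZl_LR (linearZ_LR (pass_left s s)).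
  rewrite (pass_leftE (s_mon _ _ Db) (s_mon _ _ (iter_alpha_in alpha_in _ Db))).
  by rewrite linearZr_LR -!iterD addnC.
Qed.

Lemma left_transpositionP : left_transposition s.
Proof.
split; first exact: left_spaceP.
- move=> h; elim/lspan_ind2: (sH h) => {h} [|u v su sv|a u su|_ [g [i [ni ->]]]].
  + by rewrite linear0l linear0r linear0.
  + by rewrite linearDl linearD su sv linearDr.
  + by rewrite linearZl_LR (linearZ_LR s) su linearZr_LR.
  + by rewrite (s_mon _ _ one_in) /= perm1 (iter_alpha1 alpha_mul).
- apply: (lin_ext (spanning_tens sH (spanning_tens sB sB))).
  move=> _ [_ [_ [[g [i [ni ->]]] [b [c [[d Db] [e Dc] ->]]] ->]]].
  rewrite -[LHS]/(s (tmap _ _ _)) -[RHS]/(tmap _ _ (pass_right _ _ _)).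
  rewrite (pass_rightE (s_mon _ _ Db) (s_mon _ _ Dc)) !tmapE !tmulE.
  by rewrite (s_part _ _ (mul_in Db Dc)) /= permM (iter_alphaM alpha_mul).
Qed.

(** For coassociativity both sides are grouped by the total exponent m. The terms with m >= n
    disappear by U^n = 0, and the coefficients agree since 1/((j)! (m - j)!) is 1/(m)! times a
    Gaussian binomial. *)
Lemma right_comoduleP : right_comodule nu.
Proof.
split.
- apply: (lin_ext sB) => b [d Db].
  rewrite -[LHS]/(tassoc _ _ _ (tmap _ _ _)) -[RHS]/(tmap _ _ _) (nu_hom Db).
  rewrite (linear_sum (nu \om idl H)) (linear_sum (tassoc B H H)) linear_sum.
  pose F j i : B \ox (H \ox H) := (wt i * wt j) *: (iter (j + i) U b \ot
    (mon (z ^- (j + i) * d.1)%g j \ot mon (z ^- i * d.1)%g i)).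
  transitivity (\sum_(j < n) \sum_(i < n) F j i).
    rewrite exchange_big; apply: eq_bigr => i _ /=.
    rewrite (linearZ_LR (nu \om idl H)) (linearZ_LR (tassoc B H H)).
    rewrite tmapE (nu_hom (iter_U_in U_in i Db)) linear_sumlz.
    rewrite (linear_sum (tassoc B H H)) scaler_sumr; apply: eq_bigr => j _ /=.
    rewrite linearZl_LR (linearZ_LR (tassoc B H H)) tassocE scalerA /F.
    by rewrite -iterD mulgA zVD.
  rewrite triangular_sum => [|j i nj|j i ni]; last 2 first.
  + by rewrite /F (wt_eq0 nj) mulr0 scale0r.
  + by rewrite /F (wt_eq0 ni) mul0r scale0r.
  rewrite big_split_ord /= [X in _ + X]big1 ?addr0 => [|m _]; last first.
    rewrite big1 // => j _; rewrite /F subnKC; last by rewrite -ltnS.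
    by rewrite (iter_U_eq0 (cd_U_nilp cd)) ?leq_addr // linear0l scaler0.
  apply: eq_bigr => m _.
  rewrite (linearZ_LR (idl B \om comul H)) tmapE comul_mon //.
  rewrite linear_sumr scaler_sumr.
  apply: eq_bigr => j _; have jm : (j <= m)%N by rewrite -ltnS.
  rewrite /F linearZr_LR scalerA subnKC //; congr (_ *: (_ \ot (_ \ot mon _ _))).
    by rewrite /qbin subnKC // mulrA wtK' // mul1r invfM mulrC.
  have -> : (z ^- m = z ^- j * z ^- (m - j))%g by rewrite -zVD subnKC.
  by rewrite -!mulgA [(z ^- (m - j) * (_ * _))%g]mulgA -(commute_z _ j) mulKg.
- move=> b; rewrite -[RHS]/(idl B b); move: b; apply: (lin_ext sB) => b [d Db].
  rewrite -[LHS]/(tunitr _ (tmap _ _ _)) (nu_hom Db).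
  rewrite (linear_sum (idl B \om counit H)) (linear_sum (tunitr B)) (bigD1 (Ordinal n_gt0)) //=.
  rewrite big1 ?addr0 => [|i]; rewrite (linearZ_LR (idl B \om counit H));
    rewrite (linearZ_LR (tunitr B)) tmapE tunitrE counit_mon.
    by rewrite wt0 !scale1r.
  by rewrite -val_eqE /= => /negPf ->; rewrite scale0r scaler0.
Qed.

Lemma comodule_algebraP : right_comodule_algebra s nu.
Proof.
split.
- exact: right_comoduleP.
- exact: left_transpositionP.
- apply: (lin_ext (spanning_tens sH sB)) => _ [_ [b [[h [j [nj ->]]] [d Db] ->]]].
  rewrite -[LHS]/(tmap _ _ (s _)) -[RHS]/(pass_right _ _ (tmap _ _ _)).
  rewrite (s_mon _ _ Db) !tmapE (nu_hom Db) (nu_hom (iter_alpha_in alpha_in _ Db)).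
  rewrite linear_sumlz linear_sumr (linear_sum (pass_right _ _)).
  apply: eq_bigr => i _.
  rewrite linearZl_LR linearZr_LR (linearZ_LR (pass_right _ _)); congr (_ *: _).
  (* Braiding exponents j and i supplies q^(ji), which matches U^i alpha^j = q^(ij) alpha^j U^i. *)
  rewrite (pass_rightE (s_mon h j (iter_U_in U_in i Db))
    (w2 := q ^+ (j * i) *: mon (z ^- i * d.1)%g i) (x2 := mon (sgval d.2 h) j)).
    rewrite (iter_U_iter_alpha U_alpha); congr (_ \ot _).
    by rewrite linearZl_LR linearZr_LR mulnC.
  by rewrite braid_mon // linearZl_LR.
- apply: (lin_ext (spanning_tens sB sB)) => _ [b [c [[d Db] [e Dc] ->]]].
  rewrite -[LHS]/(nu (tmul _ _)) -[RHS]/(tmap _ _ (tmid _ _ _ (tmap _ _ _))).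
  rewrite tmulE tmapE.
  exact: (coaction_mul gD alpha_in U_in U_alpha s_hom nu_hom
            (cd_U_nilp cd) (cd_U_mul cd) (cd_compatible cd) Db Dc).
(* The derivation rule applied to 1 = 1 * 1 reads U(1) = U(1) + U(1). *)
- have U1 : U 1 = 0.
    have := cd_U_mul cd 1 (part_grp_in gD one_in).
    rewrite !mulr1 mul1r chi1 scale1r alpha_mul.1 mulr1 => /eqP.
    by rewrite -subr_eq subrr eq_sym => /eqP.
  rewrite (nu_hom one_in) (bigD1 (Ordinal n_gt0)) //= big1 ?addr0 => [|[[|i] ni] //= _].
    by rewrite wt0 scale1r invg1 mulg1 mon10.
  by rewrite -iterS iterSr U1 iter_linear0 linear0l scaler0.
Qed.

End ComoduleAlgebraLaws.

Lemma data_comodule_algebra :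
  exists (s : {linear H \ox B -> B \ox H}) (nu : {linear B -> B \ox H}),
    [/\ transposition_formula n gr x D alpha s,
        coaction_formula q n gr x D U nu,
        right_comodule_algebra s nu
      & forall (s' : {linear H \ox B -> B \ox H}) (nu' : {linear B -> B \ox H}),
          transposition_formula n gr x D alpha s' ->
          coaction_formula q n gr x D U nu' ->
          s' =1 s /\ nu' =1 nu].
Proof.
have [s s_hom] := transposition_ex; have [nu nu_hom] := coaction_ex.
have sF := transposition_formulaP s_hom; have nuF := coaction_formulaP nu_hom.
exists s, nu; split=> //; first exact: comodule_algebraP.
move=> s' nu' s'F nu'F; split.
- apply: (lin_ext (spanning_tens spanning_mon (spanning_grad gD))).
  move=> _ [_ [b [[g [i [ni ->]]] [d Db] ->]]].
  have Pb : part_aut D d.2 b by apply: (part_in gD _ Db); apply: eqxx.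
  by rewrite [LHS](s'F _ _ _ _ ni Pb) [RHS](sF _ _ _ _ ni Pb).
- apply: (lin_ext (spanning_grad gD)) => b [d Db].
  by rewrite (nu'F _ _ (part_grp_in gD Db)) (nuF _ _ (part_grp_in gD Db)).
Qed.

End DataToComodule.

(** * From the comodule algebra to the data *)

Section ComoduleToData.
Variables (B : pzAlgebra k) (s : {linear H \ox B -> B \ox H}) (nu : {linear B -> B \ox H}).
Hypothesis ca : right_comodule_algebra s nu.
Hypothesis hpq : (chi z, q) <> (1, -1).

Let lt := ca_transposition ca.
Let ls := lt_space lt.

(** * The coefficients of the transposition *)

Lemma scoord_linear l g i : linear (fun v => tcoord g i (s (l \ot v))).
Proof. by move=> a u v; rewrite linearPr (linearP s) linearP. Qed.

Definition scoord l g i : {linear B -> B} := sval (linear_map (scoord_linear l g i)).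

Lemma scoordE l g i v : tcoord g i (s (l \ot v)) = scoord l g i v.
Proof. by rewrite /scoord; case: linear_map => f /= ->. Qed.

Lemma s_expand l v : s (l \ot v) = \sum_g \sum_(i < n) scoord l g i v \ot mon g i.
Proof.
rewrite [LHS]tcoord_expand; apply: eq_bigr => g _; apply: eq_bigr => i _.
by rewrite scoordE.
Qed.

Lemma scoord_pure l v w g i h j : (j < n)%N -> s (l \ot v) = w \ot mon h j ->
  scoord l g i v = if (g == h) && (i == j) then w else 0.
Proof. by move=> jn sE; rewrite -scoordE sE tcoord_mon. Qed.

Lemma s_pure l v w h j : (j < n)%N ->
  (forall g i, (i < n)%N -> scoord l g i v = if (g == h) && (i == j) then w else 0) ->
  s (l \ot v) = w \ot mon h j.
Proof.
move=> jn lE; apply: tcoord_inj => g i; rewrite scoordE tcoord_mon //.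
have [/lE //|ni] := ltnP i n.
by rewrite -scoordE tcoord_ge // (gtn_eqF (leq_trans jn ni)) andbF.
Qed.

Lemma scoord_ge l g i v : (n <= i)%N -> scoord l g i v = 0.
Proof. by move=> ni; rewrite -scoordE tcoord_ge. Qed.

Lemma s_inj : injective s. Proof. exact: bij_inj (ls_bij ls). Qed.

Lemma mon_tens_inj g i (v w : B) : (i < n)%N -> mon g i \ot v = mon g i \ot w -> v = w.
Proof.
move=> ni /(congr1 (lcoord g i)); rewrite !lcoordE coord_mon // !eqxx.
by rewrite !scale1r.
Qed.

Lemma scoord_one g i v : scoord 1 g i v = if (g == 1%g) && (i == 0%N) then v else 0.
Proof. by apply: (scoord_pure _ _ n_gt0); rewrite (ls_one ls) mon10. Qed.

(** The factor q^(ij) comes from braiding the arguments and q^(ab) from braiding the results.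
    Combining an instance with its mirror image multiplies a composite by a power of q. *)
Lemma scoord_braid g i h j u a w b v : (i < n)%N -> (j < n)%N ->
  q ^+ (i * j) *: scoord (mon h j) w b (scoord (mon g i) u a v) =
  q ^+ (a * b) *: scoord (mon g i) u a (scoord (mon h j) w b v).
Proof.
move=> ni nj.
have := ls_braid ls ((mon g i \ot mon h j) \ot v).
rewrite -[LHS]/(pass_left _ _ (tmap _ _ _)) -[RHS]/(tmap _ _ (pass_left _ _ _)).
rewrite tmapE braid_mon // linearZl_LR (linearZ_LR (pass_left s s)).
move/(congr1 (tcoord2 w b u a)); rewrite (linearZ_LR (tcoord2 w b u a)) /=.
have L := tcoord2_pass s w b u a (mon h j) (mon g i) v.
have R := tcoord2_pass s u a w b (mon g i) (mon h j) v.
by rewrite L (tcoord2_braid w b u a) R !scoordE [(b * a)%N]mulnC.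
Qed.

(** Comes from g being group-like. At i = j = 0 it says that the coefficients at exponent 0 are
    orthogonal idempotents. *)
Lemma scoord_gr_comul g h i h' j v :
  scoord (gr g) h i (scoord (gr g) h' j v) =
  if h' == (h * z ^+ i)%g then qbin qp i j *: scoord (gr g) h (i + j) v else 0.
Proof.
have := ls_comul ls (gr g \ot v).
rewrite -[LHS]/(tmap _ _ (s _)) -[RHS]/(pass_left _ _ (tmap _ _ _)) tmapE.
rewrite (HD_comul_g hH) => /(congr1 (tcoord2 h i h' j)).
by rewrite tcoord2_comul tcoord2_pass !scoordE => <-.
Qed.

Lemma scoord_x_comul h i h' j v :
  (if h' == (h * z ^+ i)%g then qbin qp i j *: scoord x h (i + j) v else 0) =
  (if (h == 1%g) && (i == 0%N) then scoord x h' j v else 0)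
    + scoord x h i (scoord (gr z) h' j v).
Proof.
have := ls_comul ls (x \ot v).
rewrite -[LHS]/(tmap _ _ (s _)) -[RHS]/(pass_left _ _ (tmap _ _ _)) tmapE.
rewrite (HD_comul_x hH) linearDl (linearD (pass_left s s)).
move=> /(congr1 (tcoord2 h i h' j)); rewrite (linearD (tcoord2 h i h' j)) /=.
by rewrite tcoord2_comul !tcoord2_pass !scoordE scoord_one.
Qed.

Lemma scoord_gr_sum g v : \sum_h scoord (gr g) h 0 v = v.
Proof.
have := ls_counit ls (gr g \ot v).
rewrite -[LHS]/(tunitr _ (tmap _ _ (s _))) -[RHS]/(tunitl _ (tmap _ _ _)) tmapE.
rewrite tcoord_counit tunitlE (HD_counit_g hH) scale1r => E.
by apply: etrans E; apply: eq_bigr => h _; rewrite scoordE.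
Qed.

Let qbin0 j : (j < n)%N -> qbin qp 0 j = 1. Proof. exact: qbin0l. Qed.
Let qbinr0 j : (j < n)%N -> qbin qp j 0 = 1. Proof. exact: qbin0r. Qed.

Lemma qbin1_neq0 j : (j.+1 < n)%N -> qbin qp 1 j != 0.
Proof.
move=> nj; rewrite /qbin add1n mulf_neq0 ?invr_eq0 ?mulf_neq0 //;
  apply: (qfact_neq0 n_gt1 qp_prim) => //; exact: ltnW.
Qed.

(** Composing the coefficients at exponents 1 and i gives a nonzero multiple of the one at exponent
    i + 1. *)
Lemma scoord_gr_pos g :
  (forall h v, scoord (gr g) h 1 v = 0) ->
  forall h i v, (0 < i)%N -> scoord (gr g) h i v = 0.
Proof.
move=> A1 h [//|i] v _; have [ni|] := ltnP i.+1 n; last exact: scoord_ge.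
have := scoord_gr_comul g h 1 (h * z)%g i v; rewrite A1 expg1 eqxx add1n => /esym/eqP.
by rewrite scaler_eq0 (negPf (qbin1_neq0 ni)) => /eqP.
Qed.

(** The coefficient at (h, 1) is unchanged by applying the idempotent at h after it; the braid axiom
    moves that idempotent in front, where [scoord_gr_comul] gives 0 because h z differs from h. *)
Lemma scoord_gr_pos_z1 g h i v : z != 1%g -> (0 < i)%N -> scoord (gr g) h i v = 0.
Proof.
move=> z1; move: h i v; apply: scoord_gr_pos => h v.
have := scoord_gr_comul g h 0 h 1 v.
rewrite expg0 mulg1 eqxx qbin0 // scale1r add0n => <-.
have := scoord_braid g g h 1 h 0 v n_gt0 n_gt0.
rewrite mon0 !muln0 expr0 !scale1r => ->.
rewrite scoord_gr_comul expg1; case: eqP => // E; case/eqP: z1.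
by apply: (mulgI h); rewrite mulg1.
Qed.

Lemma scoord_z_pos h i v : (0 < i)%N -> scoord (gr z) h i v = 0.
Proof.
move=> i0; have [z1|z1] := eqVneq z 1%g; last exact: scoord_gr_pos_z1.
by rewrite z1 (HD_one hH) scoord_one (gtn_eqF i0) andbF.
Qed.

(** Follows from [scoord_x_comul] and [scoord_z_pos]: at the pair (h, 0), (h, i) when h differs from
    1, and at the pair (1, 1), (z, i - 1) when h = 1 and i >= 2. *)
Lemma scoord_x_pos h i v : (0 < i)%N -> (h, i) != (1%g, 1%N) -> scoord x h i v = 0.
Proof.
move=> i0; have [ni hi|ni _] := ltnP i n; last exact: scoord_ge.
have [h1|h1] := eqVneq h 1%g; last first.
  have := scoord_x_comul h 0 h i v.
  rewrite expg0 mulg1 eqxx qbin0 // scale1r add0n (negPf h1) add0r.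
  by rewrite scoord_z_pos // linear0.
move: hi; rewrite {h}h1 xpair_eqE eqxx /=.
case: i i0 ni => [//|[//|i]] _ ni _.
have := scoord_x_comul 1%g 1 z i.+1 v.
rewrite expg1 mul1g eqxx scoord_z_pos // linear0 andbF add0r => /eqP.
by rewrite scaler_eq0 (negPf (qbin1_neq0 ni)) => /eqP.
Qed.

Definition xalpha := scoord x 1%g 1.

Lemma xalpha_z h v : xalpha (scoord (gr z) h 0 v) = if h == z then xalpha v else 0.
Proof.
have := scoord_x_comul 1%g 1 h 0 v; rewrite expg1 mul1g qbinr0 // addn0 scale1r.
by rewrite andbF add0r => <-.
Qed.

Lemma scoord_x1_z h v :
  scoord x 1%g 0 (scoord (gr z) h 0 v) = if h == 1%g then 0 else - scoord x h 0 v.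
Proof.
have := scoord_x_comul 1%g 0 h 0 v.
rewrite expg0 mulg1 qbin0 // addn0 scale1r !eqxx /=.
case: eqP => [->|_] /eqP; last by rewrite eq_sym addr_eq0 => /eqP ->; rewrite opprK.
by rewrite eq_sym -subr_eq0 addrAC subrr add0r => /eqP.
Qed.

Lemma x_tens_inj (v w : B) : x \ot v = x \ot w -> v = w.
Proof. by rewrite -mon11; apply: mon_tens_inj. Qed.

(** This is where (p, q) <> (1, -1) enters: it excludes q = -1, while q = 1 is excluded because qp
    has order n > 1. *)
Lemma sqr_q_neq1 : chi z = 1 -> q ^+ 2 != 1.
Proof.
move=> p1; apply/eqP => /eqP; rewrite -subr_eq0 subr_sqr_1 mulf_eq0.
case/orP; last by rewrite addr_eq0 => /eqP q1; apply: hpq; rewrite p1 q1.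
rewrite subr_eq0 => /eqP q1; move: (qp_prim); rewrite p1 q1 mulr1 => /prim_order_dvd.
move/(_ 1%N); rewrite expr1 eqxx dvdn1 => n1.
by move: n_gt1; rewrite (eqP n1).
Qed.

Lemma scoord_x0 h v : scoord x h 0 v = 0.
Proof.
have [p1|p1] := eqVneq (chi z) 1.
  have q2 := sqr_q_neq1 p1.
  have q20 (w : B) : w = q ^+ 2 *: w -> w = 0.
    move=> /eqP; rewrite -subr_eq0 -{1}[w]scale1r -scalerBl scaler_eq0 subr_eq0.
    by rewrite eq_sym (negPf q2) => /eqP.
  pose y := scoord x h 0 v; apply/x_tens_inj/s_inj; rewrite linear0r linear0 -/y.
  have br a i b j w := scoord_braid 1%g 1%g a i b j w n_gt1 n_gt1.
  move: br; rewrite mon11 mul1n expr1 => br.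
  (* Exchanging the two coefficients twice multiplies their composite by q^2, which differs from 1,
     so it is 0; the same works for the coefficient at (1, 1). *)
  have y0 a : scoord x a 0 y = 0.
    apply: q20; have := br h 0%N a 0%N v; have := br a 0%N h 0%N v.
    rewrite !mul0n !expr0 !scale1r -/y => E1 E2.
    by rewrite -{1}E1 -E2 scalerA -expr2.
  have y1 : scoord x 1%g 1 y = 0.
    apply: q20; have := br h 0%N 1%g 1%N v; have := br 1%g 1%N h 0%N v.
    rewrite !mul0n !muln0 !expr0 !scale1r -/y => E1 E2.
    by rewrite -{1}E1 -E2 scalerA -expr2.
  rewrite s_expand big1 // => g _; rewrite big1 // => i _.
  case: (posnP i) => [->|i0]; first by rewrite y0 linear0l.
  have [[-> ->]|gi] := eqVneq (g, i : nat) (1%g, 1%N); first by rewrite y1 linear0l.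
  by rewrite scoord_x_pos // linear0l.
(* For p <> 1 it suffices to kill the coefficient at 1 on the image of each idempotent of z: these
   images span B, and [scoord_x1_z] then carries the vanishing over to every h. *)
have gamma1z a : scoord x 1%g 0 (scoord (gr z) a 0 v) = 0.
  set w := scoord (gr z) a 0 v.
  have zw0 g : scoord (gr z) g 0 w = if g == a then w else 0.
    rewrite scoord_gr_comul expg0 mulg1 addn0 qbin0 // scale1r eq_sym.
    by case: eqP => // ->.
  have zw : s (gr z \ot w) = w \ot gr a.
    rewrite -(mon0 a); apply: s_pure => // g i ni.
    case: (posnP i) => [->|i0]; last by rewrite scoord_z_pos // andbF.
    by rewrite andbT zw0.
  have zC g i : s (gr z \ot scoord x g i w) = scoord x g i w \ot gr a.
    rewrite -(mon0 a); apply: s_pure => // g' i' ni'.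
    case: (posnP i') => [->|i0]; last by rewrite scoord_z_pos // andbF.
    have := scoord_braid 1%g z g i g' 0 w n_gt1 n_gt0.
    rewrite mon11 mon0 !muln0 expr0 !scale1r zw0 => ->.
    by rewrite andbT; case: ifP => // _; rewrite linear0.
  have zx : pass_left s s ((gr z \ot x) \ot w) =
      \sum_g \sum_(i < n) scoord x g i w \ot (gr a \ot mon g i).
    rewrite pass_left_tens s_expand linear_sumr (linear_sum (tassocV H B H)).
    rewrite (linear_sum (s \om idl H)) (linear_sum (tassoc B H H)).
    apply: eq_bigr => g _; rewrite linear_sumr (linear_sum (tassocV H B H)).
    rewrite (linear_sum (s \om idl H)) (linear_sum (tassoc B H H)).
    by apply: eq_bigr => i _; rewrite tassocVE tmapE zC tassocE.
  have xz : pass_left s s ((x \ot gr z) \ot w) =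
      \sum_g \sum_(i < n) scoord x g i w \ot (mon g i \ot gr a).
    rewrite pass_left_tens zw tassocVE tmapE s_expand linear_sumlz (linear_sum (tassoc B H H)).
    apply: eq_bigr => g _; rewrite linear_sumlz (linear_sum (tassoc B H H)).
    by apply: eq_bigr => i _; rewrite tassocE.
  (* After multiplication by [gr a], the coefficient of [mon a 0] only sees g = 1 and i = 0, where
     the scalar chi(a)^i is 1. Comparing x z with p z x thus leaves an element equal to p times
     itself. *)
  have tc0 (F : G -> G) (c : 'I_n -> k) : (forall g, (a == F g) = (g == 1%g)) ->
      c (Ordinal n_gt0) = 1 ->
      tcoord a 0 (\sum_g \sum_(i < n) scoord x g i w \ot (c i *: mon (F g) i)) =
      scoord x 1%g 0 w.
    move=> Fa c1; have E g (i : 'I_n) : tcoord a 0 (scoord x g i w \ot (c i *: mon (F g) i)) =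
        if (g == 1%g) && (i == Ordinal n_gt0) then scoord x 1%g 0 w else 0.
      rewrite linearZr_LR (linearZ_LR (tcoord a 0)) tcoord_mon // Fa.
      case: eqP => [->|_]; last by rewrite scaler0.
      have -> : (0%N == i) = (i == Ordinal n_gt0) by rewrite eq_sym.
      by case: eqP => [->|_]; rewrite ?c1 ?scale1r ?scaler0.
    transitivity (\sum_(g : G) \sum_(i < n)
        if (g == 1%g) && (i == Ordinal n_gt0) then scoord x 1%g 0 w else 0).
      rewrite (linear_sum (tcoord a 0)); apply: eq_bigr => g _.
      by rewrite (linear_sum (tcoord a 0)); apply: eq_bigr => i _; apply: E.
    rewrite (bigD1 1%g) //= [X in _ + X]big1 => [|g /negPf g1].
      by rewrite addr0 -big_mkcond (big_pred1 (Ordinal n_gt0)) // => i; rewrite eqxx.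
    by rewrite big1 // => i _; rewrite g1.
  have := ls_mul ls ((x \ot gr z) \ot w); have := ls_mul ls ((gr z \ot x) \ot w).
  rewrite -![(s \o _) _]/(s (tmap _ _ _)) -![(tmap _ _ \o _) _]/(tmap _ _ (pass_left _ _ _)).
  rewrite !tmapE !tmulE zx xz (HD_xg hH) linearZl_LR (linearZ_LR s) => ->.
  move=> /(congr1 (tcoord a 0)); rewrite (linearZ_LR (tcoord a 0)).
  have -> : (idl B \om tmul H) (\sum_g \sum_(i < n) scoord x g i w \ot (gr a \ot mon g i))
      = \sum_g \sum_(i < n) scoord x g i w \ot (1 *: mon (a * g)%g i).
    rewrite linear_sum; apply: eq_bigr => g _; rewrite linear_sum; apply: eq_bigr => i _.
    by rewrite tmapE tmulE -mon0 monM expr0 add0n.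
  have -> : (idl B \om tmul H) (\sum_g \sum_(i < n) scoord x g i w \ot (mon g i \ot gr a))
      = \sum_g \sum_(i < n) scoord x g i w \ot (chi a ^+ i *: mon (g * a)%g i).
    rewrite linear_sum; apply: eq_bigr => g _; rewrite linear_sum; apply: eq_bigr => i _.
    by rewrite tmapE tmulE -mon0 monM addn0.
  rewrite (tc0 (fun g => a * g)%g (fun=> 1)) //; last first.
    by move=> g; rewrite -{1}[a]mulg1 (inj_eq (mulgI a)) eq_sym.
  rewrite (tc0 (fun g => g * a)%g (fun i => chi a ^+ i)) //; last first.
    by move=> g; rewrite -{1}[a]mul1g (inj_eq (mulIg a)) eq_sym.
  move=> /eqP; rewrite -subr_eq0 -{2}[scoord x 1%g 0 w]scale1r -scalerBl scaler_eq0.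
  by rewrite subr_eq0 (negPf p1) => /eqP.
have [->|h1] := eqVneq h 1%g.
  by rewrite -[v in LHS](scoord_gr_sum z) linear_sum big1.
have := scoord_x1_z h v; rewrite gamma1z (negPf h1) => /eqP.
by rewrite eq_sym oppr_eq0 => /eqP.
Qed.

Lemma s_x v : s (x \ot v) = xalpha v \ot x.
Proof.
rewrite -{2}mon11; apply: s_pure => // g i _.
case: (posnP i) => [->|i0]; first by rewrite andbF scoord_x0.
have [/andP[/eqP -> /eqP ->] //|] := boolP (_ && _).
by rewrite -xpair_eqE; apply: scoord_x_pos.
Qed.

Lemma xalpha_inj : injective xalpha.
Proof. by move=> v w vw; apply/x_tens_inj/s_inj; rewrite !s_x vw. Qed.

(** By [xalpha_z] and the injectivity of [xalpha], the idempotents at h <> z vanish; since they add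
    up to the identity, the one at z is the identity. *)
Lemma s_z v : s (gr z \ot v) = v \ot gr z.
Proof.
have A0 h : h != z -> scoord (gr z) h 0 v = 0.
  by move=> /negPf hz; apply: xalpha_inj; rewrite xalpha_z hz linear0.
rewrite -{2}(mon0 z); apply: s_pure => // g i _.
case: (posnP i) => [->|i0]; last by rewrite scoord_z_pos // andbF.
rewrite andbT; have [->|/A0 //] := eqVneq g z.
by rewrite -{2}(scoord_gr_sum z v) (bigD1 z) //= big1 ?addr0.
Qed.

Lemma xalpha_scoord g h i v :
  xalpha (scoord (gr g) h i v) = q ^+ i *: scoord (gr g) h i (xalpha v).
Proof.
have := scoord_braid g 1%g h i 1%g 1 v n_gt0 n_gt1.
by rewrite mon11 mon0 mul0n expr0 scale1r muln1.
Qed.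

Lemma scoord_xalpha g h i v :
  scoord (gr g) h i (xalpha v) = q ^+ i *: xalpha (scoord (gr g) h i v).
Proof.
have := scoord_braid 1%g g 1%g 1 h i v n_gt1 n_gt0.
by rewrite mon11 mon0 muln0 expr0 scale1r mul1n.
Qed.

(** When z = 1, [xalpha_scoord] and [scoord_xalpha] together produce a factor q^2 <> 1, so the
    injective map [xalpha] annihilates the coefficients at exponent 1. *)
Lemma scoord_gr0 g h i v : (0 < i)%N -> scoord (gr g) h i v = 0.
Proof.
have [z1|z1] := eqVneq z 1%g; last exact: scoord_gr_pos_z1.
move: h i v; apply: scoord_gr_pos => h v; apply: xalpha_inj; rewrite linear0.
have := xalpha_scoord g h 1 v; rewrite scoord_xalpha scalerA -expr2 expr1 => /eqP.
rewrite -subr_eq0 -{1}[xalpha _]scale1r -scalerBl scaler_eq0 subr_eq0 eq_sym.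
by rewrite (negPf (sqr_q_neq1 _)) ?z1 ?chi1 // => /eqP.
Qed.


(** * Decomposition of B by automorphisms of G *)

Definition pureaut (f : G -> G) (b : B) := forall g, s (gr g \ot b) = b \ot gr (f g).

Lemma scoord_gr_idem g h h' v : scoord (gr g) h 0 (scoord (gr g) h' 0 v) =
  if h' == h then scoord (gr g) h 0 v else 0.
Proof. by rewrite scoord_gr_comul expg0 mulg1 qbin0 // scale1r. Qed.

Lemma scoord_gr_comm g h g' h' v :
  scoord (gr g) h 0 (scoord (gr g') h' 0 v) = scoord (gr g') h' 0 (scoord (gr g) h 0 v).
Proof.
have := scoord_braid g' g h' 0 h 0 v n_gt0 n_gt0.
by rewrite !mon0 !muln0 expr0 !scale1r.
Qed.

Lemma scoord_gr_fix g h b : scoord (gr g) h 0 b = b -> s (gr g \ot b) = b \ot gr h.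
Proof.
move=> bE; rewrite -(mon0 h); apply: s_pure => // g' i _.
case: (posnP i) => [->|i0]; last by rewrite scoord_gr0 // andbF.
by rewrite andbT -{1}bE scoord_gr_idem eq_sym; case: eqP => // ->.
Qed.

Lemma scoord_gr_pure g h b h' : s (gr g \ot b) = b \ot gr h ->
  scoord (gr g) h' 0 b = if h' == h then b else 0.
Proof. by rewrite -(mon0 h) => /(scoord_pure _ _ n_gt0) ->; rewrite andbT. Qed.

(* Successive refinement by the commuting families of idempotents
   [scoord (gr g) h 0], one family for each [g]. *)
Lemma spanning_refine (l : seq G) :
  spanning (fun b : B => forall g, g \in l -> exists h, scoord (gr g) h 0 b = b).
Proof.
elim: l => [|g l ih] v; first exact: lspan_gen.
apply: lspan_sub (ih v) => u ul; rewrite -(scoord_gr_sum g u).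
apply: lspan_sum => h _; apply: lspan_gen => g'; rewrite inE => /orP[/eqP ->|/ul[h' uE]].
  by exists h; rewrite scoord_gr_idem eqxx.
by exists h'; rewrite scoord_gr_comm uE.
Qed.

Lemma gr_tens_inj (b : B) g h : b != 0 -> b \ot gr g = b \ot gr h -> g = h.
Proof.
move=> b0 /(congr1 (tcoord g 0)); rewrite -!mon0 !tcoord_mon // eqxx /= andbT.
by case: eqP => // _ /eqP; rewrite (negPf b0).
Qed.

Lemma xalpha_pureaut f b : pureaut f b -> pureaut f (xalpha b).
Proof.
move=> fb g; apply: scoord_gr_fix; rewrite scoord_xalpha expr0 scale1r.
by rewrite (scoord_gr_pure _ (fb g)) eqxx.
Qed.

Lemma s_mulE h l v v' h' l' : s (l \ot v) = v' \ot l' ->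
  forall v'', s (h \ot v') = v'' \ot h' -> s (h * l \ot v) = v'' \ot (h' * l').
Proof.
move=> sl v'' sh; have := ls_mul ls ((h \ot l) \ot v).
rewrite -[LHS]/(s (tmap _ _ _)) -[RHS]/(tmap _ _ (pass_left _ _ _)).
by rewrite (pass_leftE sl sh) !tmapE !tmulE.
Qed.

(** A priori [f] is a mere function. Its multiplicativity comes from the compatibility of [s] with
    the product of H, its injectivity from that of [s], f(z) = z from [s_z], and the invariance of
    chi from applying [s] to x g = chi(g) g x. *)
Lemma pureaut_aut f b : b != 0 -> pureaut f b ->
  exists zeta : [subg aut_chiz chi z], sgval zeta =1 f.
Proof.
move=> b0 fb; have fM g h : f (g * h)%g = (f g * f h)%g.
  apply: (gr_tens_inj b0); rewrite -fb (HD_mul hH) (s_mulE (fb h) (fb g)).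
  by rewrite (HD_mul hH).
have f_inj : injective f.
  move=> g h gh; have /s_inj/(congr1 (lcoord g 0)) : s (gr g \ot b) = s (gr h \ot b).
    by rewrite !fb gh.
  rewrite !lcoordE -!mon0 !coord_mon // eqxx scale1r /= andbT.
  by case: eqP => // _ /eqP; rewrite scale0r (negPf b0).
have fz : f z = z by apply: (gr_tens_inj b0); rewrite -fb s_z.
have fchi g : chi (f g) = chi g.
  have a0 : xalpha b != 0 by rewrite -(linear0 xalpha) (inj_eq xalpha_inj).
  have := s_mulE (fb g) (s_x b); rewrite (HD_xg hH) linearZl_LR (linearZ_LR s).
  rewrite (s_mulE (s_x b) (xalpha_pureaut fb g)) (HD_xg hH) linearZr_LR.
  move=> /(congr1 (tcoord (f g) 1)); rewrite !(linearZ_LR (tcoord (f g) 1)).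
  have -> : gr (f g) * x = mon (f g) 1 by rewrite /mon expr1.
  rewrite tcoord_mon // !eqxx /= => /eqP; rewrite -subr_eq0 -scalerBl scaler_eq0 subr_eq0.
  by rewrite (negPf a0) orbF eq_sym => /eqP.
have pA : perm f_inj \in aut_chiz chi z.
  rewrite inE permE fz eqxx /=; apply/andP; split; last first.
    by apply/forallP => g; rewrite permE fchi.
  rewrite inE; apply/andP; split; first by apply/fintype.subsetP => g; rewrite finset.in_setT.
  by apply/morphicP => g h _ _; rewrite !permE fM.
by exists (subg _ (perm f_inj)) => g; rewrite subgK // permE.
Qed.

Lemma spanning_pureaut :
  spanning (fun b => exists zeta : [subg aut_chiz chi z], pureaut (sgval zeta) b).
Proof.
move=> v; apply: lspan_sub (spanning_refine (enum G) v) => u uE.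
have [->|u0] := eqVneq u 0; first exact: lspan0.
(* The default value 1 is never taken: for each [g] some idempotent fixes the refined vector [u]. *)
pose f g := odflt 1%g [pick h | scoord (gr g) h 0 u == u].
have fu : pureaut f u.
  move=> g; apply: scoord_gr_fix; rewrite /f; case: pickP => [h /eqP //|].
  by have [|h hE] := uE g; [rewrite mem_enum|move/(_ h); rewrite hE eqxx].
have [zeta zf] := pureaut_aut u0 fu.
by apply: lspan_gen; exists zeta => g; rewrite zf fu.
Qed.

Lemma autproj_linear (f : G -> G) (l : seq G) :
  linear (fun b => foldr (fun g c => scoord (gr g) (f g) 0 c) b l).
Proof. by elim: l => [|g l ih] a u v //=; rewrite ih linearP. Qed.

(** The composite over all [g] of the idempotents at (g, zeta g); it kills the part of zeta' as soon
    as zeta and zeta' differ at some g. *)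
Definition autproj (zeta : [subg aut_chiz chi z]) : {linear B -> B} :=
  sval (linear_map (autproj_linear (sgval zeta) (enum G))).

Lemma autproj_id (zeta zeta' : [subg aut_chiz chi z]) b : pureaut (sgval zeta') b ->
  autproj zeta b = if zeta == zeta' then b else 0.
Proof.
move=> zb; rewrite /autproj; case: linear_map => f /= ->.
have -> : foldr (fun g c => scoord (gr g) (sgval zeta g) 0 c) b (enum G) =
    if all (fun g => sgval zeta g == sgval zeta' g) (enum G) then b else 0.
  elim: (enum G) => //= g l ->; rewrite andbC; case: all; rewrite ?linear0 //=.
  exact: scoord_gr_pure.
congr (if _ then _ else _); apply/allP/eqP => [zz|-> //].
apply/val_inj/permP => g; apply/eqP; apply: zz; exact: mem_enum.
Qed.

Lemma s_pureaut (zeta : [subg aut_chiz chi z]) b g i : pureaut (sgval zeta) b ->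
  s (mon g i \ot b) = iter i xalpha b \ot mon (sgval zeta g) i.
Proof.
move=> zb; apply: (@s_mulE _ _ _ (iter i xalpha b)).
  elim: i => [|i ih] /=; first by rewrite expr0 (ls_one ls).
  by rewrite exprS; apply: s_mulE ih _ (s_x _).
suff : pureaut (sgval zeta) (iter i xalpha b) by [].
by elim: i => //= i; apply: xalpha_pureaut.
Qed.

(** * The coefficients of the coaction *)

Lemma ncoord_linear g i : linear (fun b => tcoord g i (nu b)).
Proof. by move=> a u v; rewrite !linearP. Qed.

Definition ncoord g i : {linear B -> B} := sval (linear_map (ncoord_linear g i)).

Lemma ncoordE g i b : tcoord g i (nu b) = ncoord g i b.
Proof. by rewrite /ncoord; case: linear_map => f /= ->. Qed.

Lemma ncoord_ge g i b : (n <= i)%N -> ncoord g i b = 0.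
Proof. by move=> ni; rewrite -ncoordE tcoord_ge. Qed.

Lemma ncoord_comul h i h' j b : ncoord h i (ncoord h' j b) =
  if h' == (h * z ^+ i)%g then qbin qp i j *: ncoord h (i + j) b else 0.
Proof.
have := rc_coassoc (ca_comodule ca) b.
rewrite -[LHS]/(tassoc _ _ _ (tmap _ _ _)) -[RHS]/(tmap _ _ _).
move/(congr1 (tcoord2 h i h' j)).
by rewrite tcoord2_map tcoord2_comul !ncoordE.
Qed.

Lemma ncoord_sum b : \sum_h ncoord h 0 b = b.
Proof.
have := rc_counit (ca_comodule ca) b.
rewrite -[LHS]/(tunitr _ (tmap _ _ _)) tcoord_counit => E.
by apply: etrans E; apply: eq_bigr => h _; rewrite ncoordE.
Qed.

(** The compatibility of [nu] with [s], read on coefficients; the braid supplies q^(ij). At exponent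
    0 it lets the decompositions given by [s] and by [nu] be refined simultaneously. *)
Lemma ncoord_scoord h i l h' j b :
  ncoord h i (scoord l h' j b) = q ^+ (i * j) *: scoord l h' j (ncoord h i b).
Proof.
have L (t : B \ox H) : tcoord h i (tcoord h' j ((nu \om idl H) t)) = ncoord h i (tcoord h' j t).
  elim/lspan_ind2: (spanning_tmon t) => {t} [|t u it iu|a t it|_ [v [_ [_ [a [m [mn ->]]] ->]]]].
  - by rewrite !linear0.
  - by rewrite (linearD (nu \om idl H)) !linearD it iu.
  - rewrite (linearZ_LR (nu \om idl H)) !(linearZ_LR (tcoord h' j)).
    by rewrite (linearZ_LR (tcoord h i)) it (linearZ_LR (ncoord h i)).
  - rewrite tmapE !tcoord_mon //; case: ifP => _; first exact: ncoordE.
    by rewrite !linear0.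
have R0 (w : B \ox H) a m : (m < n)%N ->
    tcoord h i (tcoord h' j (tassocV B H H ((idl B \om braid H) (tassoc B H H (w \ot mon a m))))) =
    q ^+ (i * j) *: tcoord h' j w *+ ((h == a) && (i == m)).
  move=> mn.
  elim/lspan_ind2: (spanning_tmon w) => {w} [|t u it iu|c t it|_ [v [_ [_ [b' [m' [mn' ->]]] ->]]]].
  - by rewrite linear0l !linear0 mul0rn.
  - rewrite linearDl (linearD (tassoc B H H)) (linearD (idl B \om braid H)).
    by rewrite (linearD (tassocV B H H)) !linearD it iu mulrnDl.
  - rewrite linearZl_LR (linearZ_LR (tassoc B H H)) (linearZ_LR (idl B \om braid H)).
    rewrite (linearZ_LR (tassocV B H H)) (linearZ_LR (tcoord h' j)) (linearZ_LR (tcoord h i)) it.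
    by rewrite (linearZ_LR (tcoord h' j)) -scalerMnr !scalerA mulrC.
  - rewrite tassocE tmapE braid_mon // linearZr_LR (linearZ_LR (tassocV B H H)) tassocVE.
    rewrite (linearZ_LR (tcoord h' j)) (linearZ_LR (tcoord h i)) !tcoord_mon //.
    case: ifP => [/andP[_ /eqP ->]|_]; last by rewrite linear0 !scaler0 mul0rn.
    rewrite tcoord_mon //; case: ifP => [/andP[_ /eqP ->]|_]; last by rewrite scaler0 mulr0n.
    by rewrite mulr1n mulnC.
have R (r : B \ox H) : tcoord h i (tcoord h' j (pass_right s (braid H) (l \ot r))) =
    q ^+ (i * j) *: scoord l h' j (tcoord h i r).
  elim/lspan_ind2: (spanning_tmon r) => {r} [|t u it iu|c t it|_ [v [_ [_ [a [m [mn ->]]] ->]]]].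
  - by rewrite linear0r !linear0.
  - by rewrite linearDr (linearD (pass_right _ _)) !linearD it iu.
  - rewrite linearZr_LR (linearZ_LR (pass_right _ _)) (linearZ_LR (tcoord h' j)).
    rewrite (linearZ_LR (tcoord h i)) it (linearZ_LR (tcoord h i)) (linearZ_LR (scoord _ _ _)).
    by rewrite !scalerA mulrC.
  - rewrite pass_right_tens R0 // tcoord_mon // scoordE; case: ifP => _; first by rewrite mulr1n.
    by rewrite mulr0n linear0 scaler0.
have := ca_compat ca (l \ot b).
rewrite -[LHS]/(tmap _ _ (s _)) -[RHS]/(pass_right _ _ (tmap _ _ _)) tmapE.
move/(congr1 (fun t => tcoord h i (tcoord h' j t))) => /=.
by rewrite L R scoordE ncoordE.
Qed.


(** * The joint gradation by group elements and automorphisms *)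

Lemma ncoord_gr_comm h i g h' b :
  ncoord h i (scoord (gr g) h' 0 b) = scoord (gr g) h' 0 (ncoord h i b).
Proof. by rewrite ncoord_scoord muln0 expr0 scale1r. Qed.

Lemma ncoord_pureaut f h i b : pureaut f b -> pureaut f (ncoord h i b).
Proof.
move=> fb g; apply: scoord_gr_fix.
by rewrite -ncoord_gr_comm (scoord_gr_pure _ (fb g)) eqxx.
Qed.

(** The group degree is detected by an idempotent of the coaction at exponent 0, the automorphism
    degree by the transposition. *)
Definition Dgr (d : gop chi z) : set B :=
  [set b | ncoord d.1 0 b = b /\ pureaut (sgval d.2) b].

Lemma Dgr_subspace d : subspace (Dgr d).
Proof.
split=> [|u v [nu' su] [nv sv]|a u [nu' su]]; split.
- by rewrite linear0.
- by move=> g; rewrite linear0r linear0 linear0l.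
- by rewrite linearD nu' nv.
- by move=> g; rewrite linearDr linearD su sv linearDl.
- by rewrite linearZ /= nu'.
- by move=> g; rewrite linearZr_LR (linearZ_LR s) su linearZl_LR.
Qed.

Lemma ncoord0_in (zeta : [subg aut_chiz chi z]) h b :
  pureaut (sgval zeta) b -> Dgr (h, zeta) (ncoord h 0 b).
Proof.
move=> zb; split; last exact: ncoord_pureaut.
by rewrite ncoord_comul expg0 mulg1 eqxx qbin0 // scale1r.
Qed.

Lemma spanning_Dgr : spanning (fun b => exists d, Dgr d b).
Proof.
move=> v; apply: lspan_sub (spanning_pureaut v) => u [zeta zu].
rewrite -(ncoord_sum u); apply: lspan_sum => h _; apply: lspan_gen.
by exists (h, zeta); apply: ncoord0_in.
Qed.

(** By [ncoord_comul], the coefficient at (h, i) composed with the idempotent at d.1 is 0 unless d.1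
    = h z^i. *)
Lemma ncoord_Dgr d h i b : Dgr d b ->
  ncoord h i b = if h == (z ^- i * d.1)%g then ncoord h i b else 0.
Proof.
case=> nb _; have [ni|ni] := ltnP i n; last by rewrite ncoord_ge // if_same.
rewrite -{1}nb ncoord_comul qbinr0 // addn0 scale1r.
rewrite (_ : (d.1 == _) = (h == (z ^- i * d.1)%g)) //.
apply/eqP/eqP => ->; first by rewrite -(commute_z h i) mulKg.
by rewrite -(commute_z _ i) mulKVg.
Qed.

Lemma gradation_Dgr : gradation Dgr.
Proof.
pose pr (d : gop chi z) : {linear B -> B} := ncoord d.1 0 \o autproj d.2.
apply: (gradation_of_proj (pr := pr) Dgr_subspace spanning_Dgr) => -[g zeta] [h zeta'] b Db.
rewrite -[LHS]/(ncoord g 0 (autproj zeta b)) (autproj_id _ Db.2) xpair_eqE /=.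
case: eqP => _; last by rewrite linear0 andbF.
rewrite andbT (ncoord_Dgr _ _ Db) expg0 invg1 mul1g.
by case: eqP => //= ->; case: Db.
Qed.

(** * The skew derivation *)

Lemma xU_linear : linear (fun b => \sum_h ncoord h 1 b).
Proof. by apply: linear_bigsum => h; apply: linearP. Qed.

(** Since (1)! = 1, the coaction formula forces U(b) to be the coefficient at exponent 1. Summing
    over all [h] avoids reference to degrees, as only one summand survives on a homogeneous
    element. *)
Definition xU : {linear B -> B} := sval (linear_map xU_linear).

Lemma xUE b : xU b = \sum_h ncoord h 1 b.
Proof. by rewrite /xU; case: linear_map => f /= ->. Qed.

Lemma xU_Dgr d b : Dgr d b -> xU b = ncoord (z^-1 * d.1)%g 1 b.
Proof.
move=> Db; rewrite xUE (bigD1 (z^-1 * d.1)%g) //= big1 ?addr0 // => h /negPf hz.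
by rewrite (ncoord_Dgr _ _ Db) expg1 hz.
Qed.

Lemma ncoord_in d i b : Dgr d b -> Dgr ((z ^- i * d.1)%g, d.2) (ncoord (z ^- i * d.1)%g i b).
Proof.
case=> nb zb; split; last exact: ncoord_pureaut.
rewrite ncoord_comul expg0 mulg1 eqxx add0n; have [ni|ni] := ltnP i n.
  by rewrite qbin0 // scale1r.
by rewrite !ncoord_ge // scaler0.
Qed.

Lemma xU_in d b : Dgr d b -> Dgr ((z^-1 * d.1)%g, d.2) (xU b).
Proof. by move=> Db; have := ncoord_in 1 Db; rewrite expg1 (xU_Dgr Db). Qed.

(** Each further application composes with a coefficient at exponent 1 and brings in the quantum
    integer (i + 1). This yields the coaction formula and, at exponent n, the nilpotency. *)
Lemma iter_xU d i b : Dgr d b ->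
  iter i xU b = qfact qp i *: ncoord (z ^- i * d.1)%g i b.
Proof.
move=> Db; elim: i => [|i ih] /=.
  by rewrite qfact0 scale1r invg1 mul1g; case: Db.
have [ni|ni] := ltnP i n; last first.
  by rewrite ih !ncoord_ge // ?scaler0 ?linear0 // (leq_trans ni).
rewrite ih linearZ /= (xU_Dgr (ncoord_in i Db)) /=.
have -> : (z^-1 * (z ^- i * d.1) = z ^- i.+1 * d.1)%g by rewrite mulgA expgSr invMg.
rewrite ncoord_comul.
rewrite expg1 (_ : (z ^- i * d.1)%g = (z ^- i.+1 * d.1 * z)%g); last first.
  by rewrite -mulgA -(hd_central hD d.1) expgS invMg -mulgA mulKg.
rewrite eqxx add1n scalerA; have [ni'|ni'] := ltnP i.+1 n; last first.
  by rewrite !ncoord_ge // !scaler0.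
rewrite /qbin add1n mulrCA; congr (_ *: _).
by rewrite [qfact qp 1]qfactS qfact0 qint1 !mul1r divff ?mulr1 //
  (qfact_neq0 n_gt1 qp_prim).
Qed.

Lemma nu_Dgr d b : Dgr d b ->
  nu b = \sum_(i < n) wt i *: (iter i xU b \ot mon (z ^- i * d.1)%g i).
Proof.
move=> Db; rewrite [LHS]tcoord_expand exchange_big; apply: eq_bigr => i _ /=.
rewrite (bigD1 (z ^- i * d.1)%g) //= big1 ?addr0 => [|h /negPf hz]; last first.
  by rewrite ncoordE (ncoord_Dgr _ _ Db) hz linear0l.
by rewrite (iter_xU i Db) linearZl_LR scalerA wtK' // scale1r ncoordE.
Qed.

Lemma s_Dgr d b g i : (i < n)%N -> Dgr d b ->
  s (mon g i \ot b) = iter i xalpha b \ot mon (sgval d.2 g) i.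
Proof. by move=> _ [_ zb]; apply: s_pureaut. Qed.

Lemma ncoord_xalpha h i b : ncoord h i (xalpha b) = q ^+ i *: xalpha (ncoord h i b).
Proof. by rewrite ncoord_scoord muln1. Qed.

Lemma xalpha_in d b : Dgr d b -> Dgr d (xalpha b).
Proof.
case=> nb zb; split; last exact: xalpha_pureaut.
by rewrite ncoord_xalpha expr0 scale1r nb.
Qed.

Lemma xU_xalpha b : xU (xalpha b) = q *: xalpha (xU b).
Proof.
rewrite !xUE linear_sum scaler_sumr; apply: eq_bigr => h _.
by rewrite ncoord_xalpha expr1.
Qed.

(** * Compatibility with the product of B *)

Lemma s_tmul h b c b' h' c' h'' :
  s (h \ot b) = b' \ot h' -> s (h' \ot c) = c' \ot h'' ->
  s (h \ot (b * c)) = (b' * c') \ot h''.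
Proof.
move=> sb sc; have := lt_mul lt (h \ot (b \ot c)).
rewrite -[LHS]/(s (tmap _ _ _)) -[RHS]/(tmap _ _ (pass_right _ _ _)).
by rewrite (pass_rightE sb sc) !tmapE !tmulE.
Qed.

Lemma tens_x_inj (v w : B) : v \ot x = w \ot x -> v = w.
Proof.
by rewrite -mon11 => /(congr1 (tcoord 1%g 1)); rewrite !tcoord_mon // !eqxx.
Qed.

Lemma xalpha_monoid : monoid_morphism xalpha.
Proof.
split=> [|b c]; apply: tens_x_inj; rewrite -s_x; first exact: (lt_one lt).
exact: s_tmul (s_x b) (s_x c).
Qed.

(** For surjectivity, write w (x) x as a value of [s]: in s(g x^i (x) b) the coefficient of x can be
    nonzero only for i = 1, and is then a value of [xalpha]. *)
Lemma xalpha_bij : bijective xalpha.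
Proof.
have surj w : exists v, w = xalpha v.
  suff surj_t (t : H \ox B) : exists v, tcoord 1%g 1 (s t) = xalpha v.
    have [r sr rs] := ls_bij ls; have [v vE] := surj_t (r (w \ot x)).
    by exists v; rewrite -vE rs -mon11 tcoord_mon // !eqxx.
  elim/lspan_ind2: (spanning_tens spanning_mon spanning_pureaut t) => {t}
    [|t u [v vE] [w' wE]|a t [v vE]|_ [_ [b [[g [i [ni ->]]] [zeta zb] ->]]]].
  - by exists 0; rewrite !linear0.
  - by exists (v + w'); rewrite !linearD vE wE.
  - by exists (a *: v); rewrite (linearZ_LR s) (linearZ_LR (tcoord _ _)) vE (linearZ_LR xalpha).
  - rewrite (s_pureaut _ _ zb) tcoord_mon //; case: ifP => [/andP[_ /eqP <-]|_]; first by exists b.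
    by exists 0; rewrite linear0.
exists (fun w => sval (cid (surj w))) => b; last by case: cid.
by case: cid => c /= /xalpha_inj.
Qed.

(** Apply [s] to x^n = lambda (z^n - 1) and compare the coefficients of 1, which are separate from
    those of z^n because z^n <> 1. *)
Lemma xalpha_order : twisted z lam n -> iter n xalpha =1 id.
Proof.
move=> tw b; have [f fE] := linear_map (iter_linear xalpha n).
rewrite -fE -[RHS]/(idl B b); move: b; apply: (lin_ext spanning_pureaut) => b [zeta zb].
have := s_pureaut 1%g n zb; rewrite fE aut1 /=.
rewrite -[n in mon _ n]addn0 mon_addn mul1g linearZl_LR linearBl (linearZ_LR s) linearB.
rewrite !(s_pureaut _ _ zb) aut1 autX aut_z /= linearZr_LR linearBr.
move/(congr1 (tcoord 1%g 0)); rewrite !(linearZ_LR (tcoord 1%g 0)) !(linearB (tcoord 1%g 0)) /=.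
rewrite !tcoord_mon // !eqxx /= andbT.
have /andP[lam0 zn] := tw; rewrite eq_sym (negPf zn) !sub0r.
by move/(scalerI lam0)/oppr_inj.
Qed.

Lemma xalpha_image d : (xalpha @` Dgr d)%classic = Dgr d.
Proof.
apply/seteqP; split=> b /=; first by case=> c Dc <-; apply: xalpha_in.
have [beta aK Ka] := xalpha_bij; case=> nb zb; exists (beta b) => //.
split=> [|g].
  by apply: xalpha_inj; have := ncoord_xalpha d.1 0 (beta b); rewrite expr0 scale1r Ka nb => <-.
apply: scoord_gr_fix; apply: xalpha_inj.
by rewrite xalpha_scoord expr0 scale1r Ka (scoord_gr_pure _ (zb g)) eqxx.
Qed.

Lemma xU_nilp b : iter n xU b = 0.
Proof.
have [f fE] := linear_map (iter_linear xU n).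
elim/lspan_ind2: (spanning_Dgr b) => {b} [|u v hu hv|a u hu|b [d Db]].
- exact: iter_linear0.
- by rewrite -fE linearD !fE hu hv addr0.
- by rewrite -fE linearZ /= fE hu scaler0.
- by rewrite (iter_xU n Db) ncoord_ge // scaler0.
Qed.

Lemma pureaut_mul (d e : gop chi z) b c :
  pureaut (sgval d.2) b -> pureaut (sgval e.2) c ->
  pureaut (sgval (d * e)%g.2) (b * c).
Proof. by move=> db ec g; rewrite /= permM; apply: s_tmul (db g) (ec _). Qed.

Local Notation hsum_ := (hsum xalpha xU).

(** Read off from [product_formula] and the folding of x^n. Exponent 0 gives the compatibility with
    the datum, exponent 1 the derivation rule. *)
Lemma ncoord_mul d e b c h i : Dgr d b -> Dgr e c -> (i < n)%N ->
  ncoord h i (b * c) =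
  (if h == (z ^- i * (d * e)%g.1)%g then
     hsum_ e.1 b c i + lam *: hsum_ e.1 b c (n + i) else 0)
  - (if h == (z ^- i * (z ^- n * (d * e)%g.1))%g then lam *: hsum_ e.1 b c (n + i) else 0).
Proof.
move=> Db Dc ni; rewrite -ncoordE.
have -> : nu (b * c) = (tmul B \om tmul H) (tmid B H s (nu b \ot nu c)).
  have := ca_mul ca (b \ot c).
  by rewrite -[LHS]/(nu (tmul _ _)) -[RHS]/(tmap _ _ (tmid _ _ _ (tmap _ _ _))) tmapE tmulE.
rewrite (product_formula xU_in s_Dgr nu_Dgr Db Dc) sum_mon_addn linearB.
have S (F : nat -> B) (g : nat -> G) :
    tcoord h i (\sum_(m < n) F m \ot mon (g m) m) = if h == g i then F i else 0.
  rewrite (linear_sum (tcoord h i)) (bigD1 (Ordinal ni)) //= tcoord_mon // eqxx andbT.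
  rewrite big1 ?addr0 // => m; rewrite -val_eqE /= => /negPf mi.
  by rewrite tcoord_mon // [i == _]eq_sym mi andbF.
rewrite (S (fun m => hsum_ e.1 b c m + lam *: hsum_ e.1 b c (n + m))
  (fun m => z ^- m * (d * e)%g.1)%g).
by rewrite (S (fun m => lam *: hsum_ e.1 b c (n + m))
  (fun m => z ^- m * (z ^- n * (d * e)%g.1))%g).
Qed.

Lemma wt1 : wt 1 = 1.
Proof. by rewrite /wt qfactS qfact0 qint1 mul1r invr1. Qed.

Lemma xU_mul b h c : part_grp Dgr h c ->
  xU (b * c) = b * xU c + chi h *: (xU b * xalpha c).
Proof.
move: c; apply: (part_ind gradation_Dgr) => [|u v hu hv|e c /eqP <- Dc].
- by rewrite !(mulr0, linear0) addr0.
- by rewrite !(mulrDr, linearD) hu hv addrACA.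
elim/lspan_ind2: (spanning_Dgr b) => {b} [|u v hu hv|a u hu|b [d Db]].
- by rewrite !(mul0r, linear0) addr0.
- by rewrite !(mulrDl, linearD) hu hv addrACA.
- by rewrite !(linearZ_LR xU) -!pzscalerAl (linearZ_LR xU) hu scalerDr !scalerA mulrC.
rewrite {1}xUE (eq_bigr _ (fun h _ => ncoord_mul h Db Dc n_gt1)) sumrB.
(* Summed over [h], the two occurrences of lambda S_(n + 1) cancel; the remaining S_1 is the
   right-hand side of the derivation rule. *)
rewrite -!big_mkcond !big_pred1_eq addrK /hsum big_ord_recl big_ord1 /hterm /=.
rewrite /bump /= wt0 wt1 !mul1r expr0 scale1r expr1 subnn invg1 !mul1g.
by [].
Qed.

Lemma one_Dgr : Dgr 1%g 1.
Proof.
split=> [|g]; last by rewrite /= perm1; apply: (lt_one lt).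
by rewrite -ncoordE (ca_one ca) -mon10 tcoord_mon // !eqxx.
Qed.

(** At exponent 0 the coefficients of nu(bc) are bc + lambda S_n in the product degree and -lambda
    S_n in its shift; in the untwisted case these corrections cancel or are zero. *)
Lemma compatible_Dgr : compatible lam q n Dgr xalpha xU.
Proof.
have nm d e b c (Db : Dgr d b) (Dc : Dgr e c) h := ncoord_mul h Db Dc n_gt0.
have zm d e b c : Dgr d b -> Dgr e c -> pureaut (sgval (d * e)%g.2) (b * c).
  by move=> [_ db] [_ ec]; apply: pureaut_mul.
rewrite /compatible; case: ifP => tw; last first.
  split=> [|d e b c Db Dc]; first exact: one_Dgr.
  split; last exact: zm.
  rewrite (nm _ _ _ _ Db Dc) invg1 !mul1g eqxx addn0 hsum0.
  move: tw; rewrite /twisted => /negbT; rewrite negb_and !negbK => /orP[]/eqP ->.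
    by rewrite !scale0r if_same subr0 addr0.
  by rewrite invg1 mul1g eqxx addrK.
have /andP[_ zn] := tw.
have w d e b c (Db : Dgr d b) (Dc : Dgr e c) : exists w1 w2 : B,
    [/\ Dgr (d * e)%g w1, Dgr (shift n (d * e)%g) w2, b * c = w1 + w2
      & w2 = twisted_term chi z lam q n xalpha xU e.1 b c].
  have az : ((z ^- n * (d * e)%g.1)%g == (d * e)%g.1) = false.
    apply/negbTE; apply: contraNneq zn => E.
    by rewrite -invg_eq1; apply/eqP/(mulIg (d * e)%g.1); rewrite E mul1g.
  exists (ncoord (d * e)%g.1 0 (b * c)), (ncoord (z ^- n * (d * e)%g.1)%g 0 (b * c)).
  split; try exact: (ncoord0_in _ (zm _ _ _ _ Db Dc)).
    rewrite !(nm _ _ _ _ Db Dc) invg1 !mul1g eqxx az [_ == (z ^- n * _)%g]eq_sym az eqxx.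
    by rewrite addn0 subr0 sub0r hsum0 addrK.
  by rewrite (nm _ _ _ _ Db Dc) invg1 !mul1g eqxx az addn0 sub0r twisted_termE // scaleNr.
split=> [|d e b c /w h /h[w1 [w2 [D1 D2 -> _]]]|d e b c /w h /h[w1 [w2 [D1 D2 -> <-]]]].
- exact: one_Dgr.
- apply: (partD gradation_Dgr).
    by apply: (part_in gradation_Dgr _ D1); rewrite /= eqxx.
  by apply: (part_in gradation_Dgr _ D2); rewrite /= eqxx orbT.
- apply/(component_gproj gradation_Dgr); rewrite linearD.
  rewrite (gproj_id gradation_Dgr _ D1) (gproj_id gradation_Dgr _ D2) eqxx.
  case: eqP => [/(congr1 fst) /= E|_]; last by rewrite add0r.
  case/eqP: zn; apply/eqP; rewrite -invg_eq1; apply/eqP/(mulIg (d * e)%g.1).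
  by rewrite E mul1g.
Qed.

Lemma comodule_algebra_data :
  exists (D : gop chi z -> set B) (alpha U : {linear B -> B}),
    [/\ comodule_data lam q n D alpha U,
        transposition_formula n gr x D alpha s
      & coaction_formula q n gr x D U nu].
Proof.
have cd : comodule_data lam q n Dgr xalpha xU.
  split.
  - exact: gradation_Dgr.
  - exact: xalpha_monoid.
  - exact: xalpha_bij.
  - exact: xalpha_order.
  - exact: xalpha_image.
  - exact: compatible_Dgr.
  - exact: xU_xalpha.
  - exact: xU_nilp.
  - exact: xU_in.
  - exact: xU_mul.
exists Dgr, xalpha, xU; split=> //.
- exact: transposition_formulaP cd s s_Dgr.
- exact: coaction_formulaP cd nu nu_Dgr.
Qed.

End ComoduleToData.
End HopfAlgebra.

Theorem theorem3p12 (k : fieldType) (G : finGroupType) (chi : G -> k) (z : G)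
    (lam q : k) (n : nat) (hD : hopf_datum chi z lam q n)
    (H : braidedBialgebra k) (gr : G -> H) (x : H)
    (hH : is_HD chi z lam q n gr x)
    (hpq : (chi z, q) <> (1, -1))
    (B : pzAlgebra k) :
  (forall (D : gop chi z -> set B) (alpha U : {linear B -> B}),
     comodule_data lam q n D alpha U ->
     exists (s : {linear H \ox B -> B \ox H}) (nu : {linear B -> B \ox H}),
       [/\ transposition_formula n gr x D alpha s,
           coaction_formula q n gr x D U nu,
           right_comodule_algebra s nu
         & forall (s' : {linear H \ox B -> B \ox H})
                  (nu' : {linear B -> B \ox H}),
             transposition_formula n gr x D alpha s' ->
             coaction_formula q n gr x D U nu' ->
             s' =1 s /\ nu' =1 nu])
  /\
  (forall (s : {linear H \ox B -> B \ox H}) (nu : {linear B -> B \ox H}),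
     right_comodule_algebra s nu ->
     exists (D : gop chi z -> set B) (alpha U : {linear B -> B}),
       [/\ comodule_data lam q n D alpha U,
           transposition_formula n gr x D alpha s
         & coaction_formula q n gr x D U nu]).
Proof.
split=> [D alpha U cd|s nu ca]; first exact: (data_comodule_algebra hD hH cd).
exact: (comodule_algebra_data hD hH ca hpq).
Qed.
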